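(* Let $d\ge4$. Fix integers $k\ge2$ and $n\ge k+3$ such that $\binom{n-k-2+d}{n-k}\ge k(n-k+1)$. Set $i_j=1$ for $1\le j\le k-1$ and $i_k=2$. Let $(j_1,\dots,j_s)$ be a multi-index with $s\le k$ and $j_h=1$ for all $h=1,\dots,s$. Then $F(i_1,\dots,i_k;n)\not\subseteq\overline{E(j_1,\dots,j_s;n)}$.
   Context: Work over $\mathbb{C}$ with $L=\mathcal{O}_{\mathbb{P}^n}(d)$, $|L|$ the projective space of degree $d$ hypersurfaces in $\mathbb{P}^n$. For positive integers $i_1,\dots,i_k\le\lfloor d/2\rfloor$: $E(i_1,\dots,i_k;n)\subseteq|L|$ is the set of hypersurfaces $\{f=0\}$ whose equation admits a decomposition $f=\sum_{h=1}^k f_hg_h$ with $f_h,g_h$ homogeneous, $\deg f_h=i_h$, $\deg g_h=d-i_h$; $F(i_1,\dots,i_k;n)\subseteq|L|$ is the set of hypersurfaces whose equation admits such a decomposition in which moreover $f_1,\dots,f_k$ form a regular sequence (i.e. $\{f_1=\cdots=f_k=0\}$ is a complete intersection of dimension $n-k$). Overline denotes Zariski closure in $|L|$. *)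

(* Defs.v *)
From HB Require Import structures.
From mathcomp Require Import all_boot all_order all_algebra.
From mathcomp Require Import mpoly.

Set Implicit Arguments.
Unset Strict Implicit.
Unset Printing Implicit Defensive.

Import GRing.Theory.
Local Open Scope ring_scope.

(* Homogeneous coordinates x_0,...,x_n on P^n: polynomials in n.+1 variables. *)

(* The monomials of degree exactly d in n.+1 variables: the coordinates of the
   vector space H^0(O_{P^n}(d)) of degree-d forms. *)
Definition Mon (n d : nat) : finType :=
  {m : 'X_{1..n.+1 < d.+1} | mdeg m == d}.

Definition coords (C : nzRingType) (n d : nat) (p : {mpoly C[n.+1]}) :
  'I_#|Mon n d| -> C :=
  fun j => p@_(val (val (enum_val j))).
Arguments coords {C n} d p _.

Definition form (C : nzRingType) (n d : nat) (p : {mpoly C[n.+1]}) : Prop :=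
  p \is d.-homog.
Arguments form {C n} d p.

Definition decomp (C : nzRingType) (n d k : nat) (i : 'I_k -> nat)
  (fs gs : 'I_k -> {mpoly C[n.+1]}) (p : {mpoly C[n.+1]}) : Prop :=
  (forall h, fs h \is (i h).-homog /\ gs h \is (d - i h).-homog) /\
  p = \sum_(h < k) fs h * gs h.

Definition in_ideal_first (C : nzRingType) (n k j : nat)
  (fs : 'I_k -> {mpoly C[n.+1]}) (q : {mpoly C[n.+1]}) : Prop :=
  exists a : 'I_k -> {mpoly C[n.+1]},
    q = \sum_(l < k | (l < j)%N) a l * fs l.

Definition regular_seq (C : nzRingType) (n k : nat)
  (fs : 'I_k -> {mpoly C[n.+1]}) : Prop :=
  ~ in_ideal_first k fs 1 /\
  forall (j : 'I_k) (g : {mpoly C[n.+1]}),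
    in_ideal_first j fs (g * fs j) -> in_ideal_first j fs g.

(* E(i_1..i_k; n), described by the equations f (nonzero degree-d forms);
   f and c f (c != 0) give the same point of |L|, and the condition is
   invariant under scaling. *)
Definition Eset (C : nzRingType) (n d k : nat) (i : 'I_k -> nat)
  (p : {mpoly C[n.+1]}) : Prop :=
  form d p /\ p != 0 /\ exists fs gs, decomp d i fs gs p.

Definition Fset (C : nzRingType) (n d k : nat) (i : 'I_k -> nat)
  (p : {mpoly C[n.+1]}) : Prop :=
  form d p /\ p != 0 /\
  exists fs gs, decomp d i fs gs p /\ regular_seq fs.

(* [p] lies in the Zariski closure in |L| = P(H^0(O(d))) of the set of points
   [g] with S g: every homogeneous polynomial in the coordinates of |L|
   vanishing on all points of S vanishes at [p]. *)
Definition in_closure (C : comNzRingType) (n d : nat)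
  (S : {mpoly C[n.+1]} -> Prop) (p : {mpoly C[n.+1]}) : Prop :=
  forall (e : nat) (Q : {mpoly C[#|Mon n d|]}),
    Q \is e.-homog ->
    (forall g, form d g -> g != 0 -> S g -> Q.@[coords d g] = 0) ->
    Q.@[coords d p] = 0.
Arguments in_closure {C n} d S p.

Definition idx_1_2 (k : nat) : 'I_k -> nat :=
  fun j => if val j == k.-1 then 2%N else 1%N.

Definition idx_ones (s : nat) : 'I_s -> nat := fun _ => 1%N.

Arguments Eset {C n} d {k} i p.
Arguments Fset {C n} d {k} i p.
Arguments idx_1_2 : clear implicits.
Arguments idx_ones : clear implicits.

(* Main.v *)
Require Import Defs.
From HB Require Import structures.
From mathcomp Require Import all_boot all_order all_algebra.
From mathcomp Require Import mpoly.
From mathcomp Require Import zify ring.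

(** A member of E(1,...,1) is a hypersurface containing a linear space of
dimension n-k. Consider the family f_w = x_0 g_0 + ... + x_(k-2) g_(k-2) + q g,
where q = x_(k-1) x_k + x_(k+1) x_(k+2) and w collects the free coefficients of
the cofactors. On the affine chart of the Grassmannian where the columns sigma
of an (n-k+1) x (n+1) matrix a form the identity, the condition that f_w
vanishes on the row space of a is linear in w, with coefficients polynomial in
a. Where some entry a_ji with i < k-1 is invertible, C(d-1+n-k, n-k) of the w's
can be solved for; where all these entries vanish, only n-k+1 entries of a
remain free and C(d-2+n-k, n-k) of the w's can be solved for, because q
restricts to a quadric with a coefficient 1. In both cases more w's are
eliminated than there are free entries of a, so by a count of monomials the
ideal of the incidence variety contains a nonzero polynomial h_sigma(w).

Pick w0 outside all the zero sets of the h_sigma. In every chart the equations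
of incidence with f0 = f_w0 then generate the unit ideal. Homogenized in the
Pluecker coordinates p, this expresses all monomials of some high degree in p
as combinations, with coefficients linear in t f0 - g, of such monomials, valid
at p whenever g vanishes on the corresponding linear space (t is a linear form
in g that is 1 at f0). Hence det (t I - M(t f0 - g)) vanishes on E(1,...,1),
while it is 1 at f0. *)

Set Implicit Arguments.
Unset Strict Implicit.
Unset Printing Implicit Defensive.

Import GRing.Theory.
Local Open Scope ring_scope.

(** * Monomial counting *)

Section PolynomialCount.
Variable C : fieldType.

Lemma leq_msizeM (M : nat) (p q : {mpoly C[M]}) :
  (msize (p * q) <= (msize p + msize q).-1)%N.
Proof.
have [->|p0] := eqVneq p 0; first by rewrite mul0r msize0.
have [->|q0] := eqVneq q 0; first by rewrite mulr0 msize0.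
by rewrite msizeM.
Qed.

Lemma leq_msize_exp (M : nat) (p : {mpoly C[M]}) (a b : nat) :
  (msize p <= a.+1)%N -> (msize (p ^+ b) <= (b * a).+1)%N.
Proof.
move=> ha; elim: b => [|b IH]; first by rewrite expr0 msize1.
rewrite exprS; have := leq_msizeM p (p ^+ b); rewrite mulSn. lia.
Qed.

Lemma leq_msize_prod (M N : nat) (F : 'I_N -> {mpoly C[M]}) (a : 'I_N -> nat) :
  (forall i, msize (F i) <= (a i).+1)%N ->
  (msize (\prod_i F i) <= (\sum_i a i).+1)%N.
Proof.
move=> h; elim/big_ind2: _ => [|a1 p1 a2 p2 h1 h2|i _] //; first by rewrite msize1.
have := leq_msizeM p1 p2; lia.
Qed.

Lemma wide_matrix_kernel (m n : nat) (A : 'M[C]_(m, n)) :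
  (n < m)%N -> exists2 v : 'rV[C]_m, v != 0 & v *m A = 0.
Proof.
move=> lt_nm; have : kermx A != 0.
  rewrite kermx_eq0 /row_free; apply/eqP => e.
  by have := rank_leq_col A; rewrite e leqNgt lt_nm.
by case/rowV0Pn => v /sub_kermxP vA vn0; exists v.
Qed.

(** Dimension count: the [b ^ N] products have degree below [B <= K * b], hence lie in a space of
    dimension at most [(K * b) ^ M], and [b > K ^ M] makes this smaller than [b ^ M.+1 <= b ^ N].
    The power of [P0] homogenizes, so the relation is an algebraic dependence of the fractions
    [P i / P0] with denominators cleared. *)
Lemma bounded_power_products_dependent (M N : nat) (P0 : {mpoly C[M]})
    (P : 'I_N -> {mpoly C[M]}) : (M < N)%N ->
  exists (b : nat) (c : {ffun 'I_N -> 'I_b} -> C),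
    (exists al, c al != 0) /\
    \sum_al c al *: (P0 ^+ (N * b - \sum_i al i) * \prod_i P i ^+ al i) = 0.
Proof.
move=> lt_MN.
pose kap := (msize P0 + \sum_i msize (P i))%N.
pose K := ((kap * N).+1)%N; pose b := ((K ^ M).+1)%N.
pose B := ((N * b * kap).+1)%N.
pose G (al : {ffun 'I_N -> 'I_b}) :=
  P0 ^+ (N * b - \sum_i al i) * \prod_i P i ^+ al i.
have hal (al : {ffun 'I_N -> 'I_b}) : (\sum_i al i <= N * b)%N.
  have : (\sum_(i < N) (al i : nat) <= \sum_(i < N) b)%N.
    by apply: leq_sum => i _; apply/ltnW/ltn_ord.
  by rewrite sum_nat_const card_ord.
have hG al : (msize (G al) <= B)%N.
  have h0 : (msize P0 <= kap.+1)%N by rewrite /kap; lia.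
  have hi i : (msize (P i) <= kap.+1)%N.
    by rewrite /kap (bigD1 i) //=; lia.
  have h1 := leq_msize_exp (N * b - \sum_i al i) h0.
  have h2 := leq_msize_prod (fun i => leq_msize_exp (al i) (hi i)).
  have := leq_msizeM (P0 ^+ (N * b - \sum_i al i)) (\prod_i P i ^+ al i).
  rewrite -/(G al) /B => h3; apply: leq_trans h3 _.
  rewrite -big_distrl /= in h2.
  have e : (N * b * kap = (N * b - \sum_i al i) * kap + (\sum_i al i) * kap)%N.
    by rewrite -mulnDl subnK.
  rewrite e; move: h1 h2; set x := (_ * kap)%N; set y := (_ * kap)%N.
  by move: (mmeasure _ _) (mmeasure _ _) x y => *; lia.
(* Degree below [B] forces every exponent below [B], so this box of exponents covers all monomials
   that occur. *)
pose mon (u : {ffun 'I_M -> 'I_B}) : 'X_{1..M} := [multinom (u i : nat) | i < M].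
pose A : 'M[C]_(#|{ffun 'I_N -> 'I_b}|, #|{ffun 'I_M -> 'I_B}|) :=
  \matrix_(i, j) (G (enum_val i))@_(mon (enum_val j)).
have cardlt : (#|{ffun 'I_M -> 'I_B}| < #|{ffun 'I_N -> 'I_b}|)%N.
  rewrite !card_ffun !card_ord.
  have hB : (B <= K * b)%N by rewrite /B /K; lia.
  apply: (@leq_ltn_trans ((K * b) ^ M)); first by case: (M) => // M'; rewrite leq_exp2r.
  apply: (@leq_trans (b ^ M.+1)); last by rewrite leq_pexp2l.
  by rewrite expnMn expnS ltn_pmul2r ?expn_gt0.
have [v vn0 vA] := wide_matrix_kernel A cardlt.
exists b, (fun al => v 0 (enum_rank al)); split.
  case/matrix0Pn: vn0 => i [j vij]; exists (enum_val j).
  by rewrite enum_valK -(ord1 i).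
apply/mpolyP => m; rewrite mcoeff0 raddf_sum /=.
case: (ltnP (mdeg m) B) => hm; last first.
  apply: big1 => al _; rewrite mcoeffZ -/(G al).
  by rewrite (memN_msupp_eq0 (msize_mdeg_ge (leq_trans (hG al) hm))) mulr0.
have lt_m i : (m i < B)%N.
  by apply: leq_ltn_trans hm; rewrite mdegE (bigD1 i) //= leq_addr.
pose u : {ffun 'I_M -> 'I_B} := [ffun i => Ordinal (lt_m i)].
have mu : mon u = m by apply/mnmP => i; rewrite mnmE ffunE.
have := congr1 (fun x : 'rV_ _ => x 0 (enum_rank u)) vA; rewrite !mxE => vA0; apply: etrans vA0.
rewrite (reindex (fun i : 'I_#|{ffun 'I_N -> 'I_b}| => enum_val i)) /=; last first.
  by exists enum_rank => x _; rewrite ?enum_valK ?enum_rankK.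
by apply: eq_bigr => i _; rewrite mcoeffZ !mxE enum_valK enum_rankK mu.
Qed.

End PolynomialCount.

(** * Elimination modulo an ideal *)

Section Ideals.
Variable S : comNzRingType.

Definition ideal (I : S -> Prop) : Prop :=
  [/\ I 0, forall x y, I x -> I y -> I (x + y) & forall x y, I y -> I (x * y)].

Definition eqmod (I : S -> Prop) (x y : S) : Prop := I (x - y).

Variables (I : S -> Prop) (idI : ideal I).

Lemma ideal0 : I 0. Proof. by case: idI. Qed.

Lemma idealD x y : I x -> I y -> I (x + y). Proof. by case: idI => _ h _; apply: h. Qed.

Lemma ideal_mull x y : I y -> I (x * y). Proof. by case: idI => _ _; apply. Qed.

Lemma ideal_mulr x y : I x -> I (x * y). Proof. by rewrite mulrC; apply: ideal_mull. Qed.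

Lemma idealN x : I x -> I (- x). Proof. by rewrite -mulN1r; apply: ideal_mull. Qed.

Lemma idealB x y : I x -> I y -> I (x - y).
Proof. by move=> hx hy; apply: idealD => //; apply: idealN. Qed.

Lemma ideal_sum (T : Type) (r : seq T) (P : pred T) (F : T -> S) :
  (forall i, P i -> I (F i)) -> I (\sum_(i <- r | P i) F i).
Proof. by move=> h; elim/big_ind: _ => //; [exact: ideal0 | exact: idealD]. Qed.

Lemma eqmod_refl x : eqmod I x x.
Proof. by rewrite /eqmod subrr; apply: ideal0. Qed.

Lemma eqmod_sym x y : eqmod I x y -> eqmod I y x.
Proof. by rewrite /eqmod -(opprB x y); apply: idealN. Qed.

Lemma eqmod_trans y x z : eqmod I x y -> eqmod I y z -> eqmod I x z.
Proof. by move=> h1 h2; have := idealD h1 h2; rewrite addrA subrK. Qed.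

Lemma eqmodD x x' y y' : eqmod I x x' -> eqmod I y y' -> eqmod I (x + y) (x' + y').
Proof. by rewrite /eqmod opprD addrACA; apply: idealD. Qed.

Lemma eqmodM x x' y y' : eqmod I x x' -> eqmod I y y' -> eqmod I (x * y) (x' * y').
Proof.
move=> hx hy; rewrite /eqmod.
have -> : x * y - x' * y' = (x - x') * y + x' * (y - y') by ring.
by apply: idealD; [apply: ideal_mulr | apply: ideal_mull].
Qed.

Lemma eqmodX x x' a : eqmod I x x' -> eqmod I (x ^+ a) (x' ^+ a).
Proof.
move=> h; elim: a => [|a IH]; first by rewrite !expr0; apply: eqmod_refl.
by rewrite !exprS; apply: eqmodM.
Qed.

Lemma eqmod_sumr (T : Type) (r : seq T) (P : pred T) (F G : T -> S) :
  (forall i, P i -> eqmod I (F i) (G i)) ->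
  eqmod I (\sum_(i <- r | P i) F i) (\sum_(i <- r | P i) G i).
Proof.
by move=> h; elim/big_ind2: _ => //; [exact: eqmod_refl | move=> *; apply: eqmodD].
Qed.

Lemma eqmod_prodr (T : Type) (r : seq T) (P : pred T) (F G : T -> S) :
  (forall i, P i -> eqmod I (F i) (G i)) ->
  eqmod I (\prod_(i <- r | P i) F i) (\prod_(i <- r | P i) G i).
Proof.
by move=> h; elim/big_ind2: _ => //; [exact: eqmod_refl | move=> *; apply: eqmodM].
Qed.

Lemma ideal_eqmod x y : eqmod I x y -> I y -> I x.
Proof. by move=> h hy; have := idealD h hy; rewrite subrK. Qed.

End Ideals.

Section Elimination.
Variables (C : fieldType) (S : comNzRingType) (phi : {rmorphism C -> S}).
Variables (I : S -> Prop) (idI : ideal I).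
Variables (M : nat) (z : 'I_M -> S) (delta : S).

(** In the localization of [S / I] at [delta], the class of [s] lies in the subring generated by the
    constants, the [z i] and the inverse of [delta]; this is stated without forming quotient or
    localization. *)
Definition rational_in (s : S) : Prop :=
  exists (e : nat) (P : {mpoly C[M]}), eqmod I (delta ^+ e * s) (mmap phi z P).

Hypothesis delta_poly : exists P : {mpoly C[M]}, eqmod I delta (mmap phi z P).

Lemma rational_in_ideal s : I s -> rational_in s.
Proof.
move=> hs; exists 0%N, 0; rewrite expr0 mul1r rmorph0 /eqmod subr0.
exact: hs.
Qed.

Lemma rational_in_const c : rational_in (phi c).
Proof. by exists 0%N, c%:MP; rewrite expr0 mul1r mmapC; apply: eqmod_refl. Qed.

Lemma rational_in_gen i : rational_in (z i).
Proof. by exists 0%N, 'X_i; rewrite expr0 mul1r mmapX mmap1U; apply: eqmod_refl. Qed.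

Lemma rational_inD s t : rational_in s -> rational_in t -> rational_in (s + t).
Proof.
case: delta_poly => P0 h0 [e [P hP]] [e' [P' hP']].
exists (e + e')%N, (P0 ^+ e' * P + P0 ^+ e * P').
rewrite rmorphD !rmorphM !rmorphXn /= mulrDr; apply: eqmodD => //.
- rewrite addnC exprD -mulrA; apply: eqmodM => //; exact: eqmodX.
- rewrite exprD -mulrA; apply: eqmodM => //; exact: eqmodX.
Qed.

Lemma rational_inM s t : rational_in s -> rational_in t -> rational_in (s * t).
Proof.
move=> [e [P hP]] [e' [P' hP']]; exists (e + e')%N, (P * P').
by rewrite rmorphM exprD mulrACA; apply: eqmodM.
Qed.

Lemma rational_in_sum (T : Type) (r : seq T) (Q : pred T) (F : T -> S) :
  (forall i, Q i -> rational_in (F i)) -> rational_in (\sum_(i <- r | Q i) F i).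
Proof.
move=> h; elim/big_ind: _ => //; last exact: rational_inD.
exact: rational_in_ideal (ideal0 idI).
Qed.

Lemma rational_in_div s : rational_in (delta * s) -> rational_in s.
Proof. by case=> e [P hP]; exists e.+1, P; rewrite exprSr -mulrA. Qed.

Lemma rational_in_eqmod s t : eqmod I s t -> rational_in t -> rational_in s.
Proof.
move=> h ht; rewrite -(subrK t s); apply: rational_inD => //.
exact: rational_in_ideal.
Qed.

(** With [E] the sum of the exponents, every [delta ^+ E * w i] is a polynomial in [z] modulo [I].
    These [N] polynomials in [M < N] variables, over the common denominator [delta ^+ E], are
    algebraically dependent, and the dependence carries over to the [w i]. *)
Lemma rational_in_relation (N : nat) (w : 'I_N -> S) :
  (M < N)%N -> (forall i, rational_in (w i)) ->
  exists (e : nat) (h : {mpoly C[N]}), h != 0 /\ I (delta ^+ e * mmap phi w h).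
Proof.
move=> ltMN /fin_all_exists [e /fin_all_exists [P hP]].
case: delta_poly => P0 h0; pose E := (\sum_i e i)%N.
have [b [c [[al0 cal0] c0]]] :=
  bounded_power_products_dependent (P0 ^+ E) (fun i => P0 ^+ (E - e i) * P i) ltMN.
pose mon (al : {ffun 'I_N -> 'I_b}) : 'X_{1..N} := [multinom (al i : nat) | i < N].
have mon_inj : injective mon.
  move=> al al' /mnmP eq_al; apply/ffunP => i; apply: val_inj.
  by have := eq_al i; rewrite !mnmE.
exists (E * (N * b))%N, (\sum_al c al *: 'X_[mon al]); split.
  apply: contraNneq cal0 => h; have := congr1 (mcoeff (mon al0)) h.
  rewrite raddf_sum /= (bigD1 al0) //= mcoeffZ mcoeffX eqxx mulr1 big1 ?addr0.
    by rewrite mcoeff0 => ->.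
  by move=> al ne; rewrite mcoeffZ mcoeffX (inj_eq mon_inj) (negPf ne) mulr0.
apply: (ideal_eqmod idI (y := mmap phi z 0)); last first.
  by rewrite rmorph0; apply: ideal0.
rewrite -c0 exprM !rmorph_sum /= mulr_sumr; apply: eqmod_sumr => // al _.
rewrite !mmapZ mulrCA; apply: eqmodM => //; first exact: eqmod_refl.
have hal : (\sum_i al i <= N * b)%N.
  have : (\sum_(i < N) (al i : nat) <= \sum_(i < N) b)%N.
    by apply: leq_sum => i _; apply/ltnW/ltn_ord.
  by rewrite sum_nat_const card_ord.
rewrite -{1}(subnK hal) exprD -mulrA mmapX rmorphM rmorphXn rmorph_prod /=.
apply: eqmodM => //; first by apply: eqmodX => //; rewrite rmorphXn; apply: eqmodX.
rewrite -prodrXr /mmap1 -big_split /=; apply: eqmod_prodr => // i _.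
rewrite mnmE -exprMn rmorphXn /=; apply: eqmodX => //.
have hi : (e i <= E)%N by rewrite /E (bigD1 i) //= leq_addr.
rewrite -{1}(subnK hi) exprD -mulrA rmorphM rmorphXn; apply: eqmodM => //.
exact: eqmodX.
Qed.

End Elimination.

(** * Gluing relations from localizations and a closed locus *)

Section IdealCombination.
Variable S : comNzRingType.

Definition span (U : finType) (G : U -> S) (s : S) : Prop :=
  exists c : U -> S, s = \sum_u c u * G u.

Lemma span_ideal (U : finType) (G : U -> S) : ideal (span G).
Proof.
split.
- by exists (fun=> 0); rewrite big1 // => u _; rewrite mul0r.
- move=> x y [c ->] [c' ->]; exists (fun u => c u + c' u).
  by rewrite -big_split /=; apply: eq_bigr => u _; rewrite mulrDl.
- move=> x y [c ->]; exists (fun u => x * c u).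
  by rewrite mulr_sumr; apply: eq_bigr => u _; rewrite mulrA.
Qed.

Lemma span_gen (U : finType) (G : U -> S) u : span G (G u).
Proof.
exists (fun v => (v == u)%:R); rewrite (bigD1 u) //= eqxx mul1r big1 ?addr0 //.
by move=> v /negPf ->; rewrite mul0r.
Qed.

(** In every term of the binomial expansion either the exponent of [x] is at least [p] or that of
    [y] is at least [q]. *)
Lemma ideal_power_colonD (I : S -> Prop) (H x y : S) (p q : nat) : ideal I ->
  I (x ^+ p * H) -> I (y ^+ q * H) -> I ((x + y) ^+ (p + q) * H).
Proof.
move=> idI hx hy; rewrite exprDn mulr_suml; apply: ideal_sum => // i _.
rewrite -mulr_natr; case: (leqP q i) => hi.
  rewrite (_ : _ * _ * H = x ^+ (p + q - i) * 'C(p + q, i)%:R * y ^+ (i - q) * (y ^+ q * H)).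
    exact: ideal_mull.
  have -> : y ^+ i = y ^+ (i - q) * y ^+ q by rewrite -exprD subnK.
  by move: (_ ^+ (i - q)) (_ ^+ (p + q - i)) => u v; ring.
have hp : (p <= p + q - i)%N by lia.
rewrite (_ : _ * _ * H = x ^+ (p + q - i - p) * 'C(p + q, i)%:R * y ^+ i * (x ^+ p * H)).
  exact: ideal_mull.
have -> : x ^+ (p + q - i) = x ^+ (p + q - i - p) * x ^+ p by rewrite -exprD subnK.
by move: (_ ^+ (p + q - i - p)) (_ ^+ i) => u v; ring.
Qed.

Lemma ideal_power_colon_sum (I : S -> Prop) (H : S) (T : finType) (F : T -> S) :
  ideal I -> (forall t, exists p, I (F t ^+ p * H)) ->
  exists p, I ((\sum_t F t) ^+ p * H).
Proof.
move=> idI hF; elim/big_ind: _ => //.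
  by exists 1%N; rewrite expr1 mul0r; apply: ideal0.
move=> x y [p hp] [q hq]; exists (p + q)%N; exact: ideal_power_colonD.
Qed.

(* Modulo the ideal, each a_l is nilpotent up to the factor h1_l; hence a power
   of h2 times the product of the h1_l lies in the ideal. *)
Lemma span_sum_relation (C : fieldType) (phi : {rmorphism C -> S}) (N : nat)
    (w : 'I_N -> S) (U L : finType) (G : U -> S) (a : L -> S) :
  (forall l, exists (e : nat) (h : {mpoly C[N]}),
     h != 0 /\ span G (a l ^+ e * mmap phi w h)) ->
  (exists h : {mpoly C[N]}, h != 0 /\
     span (fun u : U + L => match u with inl u => G u | inr l => a l end)
       (mmap phi w h)) ->
  exists h : {mpoly C[N]}, h != 0 /\ span G (mmap phi w h).
Proof.
move=> /fin_all_exists [e /fin_all_exists [h1 hh1]] [h2 [h2n0 [c hc]]].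
have idG := span_ideal G.
pose H := \prod_l h1 l; have Hn0 : H != 0.
  by apply/prodf_neq0 => l _; case: (hh1 l).
have [u|] := @ideal_power_colon_sum (span G) (mmap phi w H) (U + L)%type
  (fun u => c u * match u with inl u => G u | inr l => a l end) idG.
  case: u => [u|l].
    by exists 1%N; rewrite expr1 /=; apply: (ideal_mulr idG); apply/(ideal_mull idG)/span_gen.
  exists (e l); rewrite /= exprMn -mulrA; apply: (ideal_mull idG).
  rewrite /H (bigD1 l) //= rmorphM mulrA; apply: (ideal_mulr idG).
  by case: (hh1 l).
move=> p hp; exists (h2 ^+ p * H); split; first by rewrite mulf_neq0 ?expf_neq0.
by rewrite rmorphM rmorphXn /= hc.
Qed.

End IdealCombination.

(** * Restriction to a linear subspace *)

Section Restriction.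
Variables (C : fieldType) (S : comNzRingType) (phi : {rmorphism C -> S}).
Variables (r n : nat).

Definition linear_row (A : 'M[S]_(r, n)) (i : 'I_n) : {mpoly S[r]} :=
  \sum_j A j i *: 'X_j.

(** Pullback of [f] under y |-> y A, that is, [f] on the row space of [A]. The entries lie in an
    arbitrary [S], so [A] may be a generic matrix as well as a point. *)
Definition restrict (A : 'M[S]_(r, n)) (f : {mpoly C[n]}) : {mpoly S[r]} :=
  mmap (@mpolyC r S \o phi) (linear_row A) f.

Lemma restrictX A i : restrict A 'X_i = linear_row A i.
Proof. by rewrite /restrict mmapX mmap1U. Qed.

Lemma restrictM A f g : restrict A (f * g) = restrict A f * restrict A g.
Proof. exact: rmorphM. Qed.

Lemma restrictD A f g : restrict A (f + g) = restrict A f + restrict A g.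
Proof. exact: rmorphD. Qed.

Lemma restrictZ A c f : restrict A (c *: f) = phi c *: restrict A f.
Proof. by rewrite /restrict mmapZ mul_mpolyC. Qed.

Lemma restrict_sum A (T : Type) (s : seq T) (P : pred T) (F : T -> {mpoly C[n]}) :
  restrict A (\sum_(t <- s | P t) F t) = \sum_(t <- s | P t) restrict A (F t).
Proof. exact: rmorph_sum. Qed.

Lemma mcoeff_linear_row A i (j : 'I_r) : (linear_row A i)@_U_(j) = A j i.
Proof.
rewrite raddf_sum (bigD1 j) //= mcoeffZ mcoeffX eqxx mulr1 big1 ?addr0 // => l ne.
by rewrite mcoeffZ mcoeffXU (negPf ne) mulr0.
Qed.

Lemma mcoeff_linear_row0 A i (m : 'X_{1..r}) :
  (forall j, m != U_(j)%MM) -> (linear_row A i)@_m = 0.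
Proof.
move=> h; rewrite raddf_sum big1 // => j _ /=.
by rewrite mcoeffZ mcoeffX eq_sym (negPf (h j)) mulr0.
Qed.

Definition mcoeffs_in (I : S -> Prop) (p : {mpoly S[r]}) : Prop := forall m, I p@_m.

Lemma mcoeffs_in_ideal (I : S -> Prop) : ideal I -> ideal (mcoeffs_in I).
Proof.
move=> idI; split.
- by move=> m; rewrite mcoeff0; apply: ideal0.
- by move=> x y hx hy m; rewrite mcoeffD; apply: idealD.
- move=> x y hy m; rewrite mcoeffM; apply: ideal_sum => // k _.
  exact: ideal_mull.
Qed.

(** The monomial in the variables x_(sigma j) that restricts to ['X_[m]] when the columns [sigma] of
    [A] form the identity. *)
Definition monomial_image (sigma : 'I_r -> 'I_n) (m : 'X_{1..r}) : 'X_{1..n} :=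
  (\sum_j U_(sigma j) *+ m j)%MM.

Lemma monomial_imageE sigma m (j : 'I_r) :
  injective sigma -> monomial_image sigma m (sigma j) = m j.
Proof.
move=> inj; rewrite mnm_sumE (bigD1 j) //= mulmnE mnm1E eqxx mul1n big1 ?addn0 //.
by move=> l ne; rewrite mulmnE mnm1E (inj_eq inj) (negPf ne).
Qed.

Lemma monomial_image_inj sigma :
  injective sigma -> injective (monomial_image sigma).
Proof.
move=> inj m m' e; apply/mnmP => j.
by rewrite -(monomial_imageE m j inj) e monomial_imageE.
Qed.

Lemma mdeg_monomial_image sigma m : mdeg (monomial_image sigma m) = mdeg m.
Proof.
rewrite mdeg_sum mdegE; apply: eq_bigr => j _.
by rewrite mdegMn mdeg1 mul1n.
Qed.

Section Chart.
Variables (I : S -> Prop) (idI : ideal I).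
Variables (A : 'M[S]_(r, n)) (sigma : 'I_r -> 'I_n).
Hypothesis chart : forall j j', eqmod I (A j (sigma j')) (j == j')%:R.

Lemma chart_linear_row j :
  eqmod (mcoeffs_in I) (linear_row A (sigma j)) 'X_j.
Proof.
have idM := mcoeffs_in_ideal idI.
have -> : 'X_j = \sum_l (l == j)%:R *: 'X_l :> {mpoly S[r]}.
  rewrite (bigD1 j) //= eqxx scale1r big1 ?addr0 // => l ne.
  by rewrite (negPf ne) scale0r.
apply: eqmod_sumr => // l _ m; rewrite -scalerBl mcoeffZ; apply: ideal_mulr => //.
exact: chart.
Qed.

Lemma chart_restrict_monomial m :
  eqmod (mcoeffs_in I) (restrict A 'X_[monomial_image sigma m]) 'X_[m].
Proof.
have idM := mcoeffs_in_ideal idI.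
rewrite /monomial_image -mprodXnE [X in eqmod _ X]rmorph_prod mpolyXE_id.
apply: eqmod_prodr => // j _; rewrite rmorphXn /=; apply: (eqmodX idM).
by rewrite mmapX mmap1U; apply: chart_linear_row.
Qed.

Variables (M : nat) (z : 'I_M -> S) (delta : S).
Hypothesis delta_poly : exists P : {mpoly C[M]}, eqmod I delta (mmap phi z P).
Local Notation rational := (rational_in phi I z delta).

Hypothesis rationalA : forall j i, rational (A j i).

Lemma rational_mcoeff_restrict f m : rational (restrict A f)@_m.
Proof.
have hM (p q : {mpoly S[r]}) : (forall m, rational p@_m) ->
    (forall m, rational q@_m) -> forall m, rational (p * q)@_m.
  move=> hp hq m'; rewrite mcoeffM; apply: rational_in_sum => // k _.
  exact: rational_inM.
have h0 : rational 0 by apply: rational_in_ideal; apply: ideal0.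
have h1 : rational 1 by rewrite -(rmorph1 phi); apply: rational_in_const.
rewrite /restrict /mmap raddf_sum; apply: rational_in_sum => // k _ /=.
rewrite mcoeffCM; apply: rational_inM => //; first exact: rational_in_const.
move: m; rewrite /mmap1; elim/big_ind: _ => //.
  by move=> m; rewrite mcoeff1; case: (m == _).
move=> i _; elim: (k i) => [|e IH] m; last first.
  rewrite exprS; apply: hM => // m'; rewrite raddf_sum.
  apply: rational_in_sum => // j _ /=; rewrite mcoeffZ mcoeffX.
  by apply: rational_inM => //; case: (_ == _).
by rewrite expr0 mcoeff1; case: (m == _).
Qed.

(* Comparing the coefficients at [gm t + eps] of [\sum_j w_j (b_j restricted)]
   solves for [w (iota t)] in terms of those [w (iota t')] for which the
   [Omega]-degree of [gm t'] is larger. *)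
Lemma rational_by_triangularity (J T : finType) (b : J -> {mpoly C[n]}) (w : J -> S)
    (gm : T -> 'X_{1..r}) (iota : T -> J) (q : {mpoly C[n]})
    (eps : 'X_{1..r}) (Omega : pred 'I_r) :
  injective gm -> injective iota ->
  (forall t, b (iota t) = q * 'X_[monomial_image sigma (gm t)]) ->
  (forall t, I (\sum_j w j * (restrict A (b j))@_(gm t + eps))) ->
  eqmod I (restrict A q)@_eps delta ->
  (forall m, m != eps -> (\sum_(j | Omega j) eps j <= \sum_(j | Omega j) m j)%N ->
     I (restrict A q)@_m) ->
  (forall j, j \notin codom iota -> rational (w j)) ->
  forall j, rational (w j).
Proof.
move=> gm_inj iota_inj hb hF heps hother hw.
suff hT t : rational (w (iota t)).
  move=> j; case: (boolP (j \in codom iota)) => [/codomP [t ->]|]; first exact: hT.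
  exact: hw.
pose om (m : 'X_{1..r}) := (\sum_(j | Omega j) m j)%N.
have omD m m' : om (m + m')%MM = (om m + om m')%N.
  by rewrite /om -big_split /=; apply: eq_bigr => j _; rewrite mnmDE.
pose B := (\sum_t om (gm t))%N.
have hB u : (om (gm u) <= B)%N by rewrite /B (bigD1 u) //= leq_addr.
(* Descending induction on the [Omega]-degree of [gm t]. *)
have [v] := ubnP (B - om (gm t))%N; elim: v t => // v IH t lt_v.
(* The coefficient of [w (iota t)] in the equation at [m] is [delta] modulo [I], so
   [delta * w (iota t)] is minus the sum of the other terms. *)
apply: rational_in_div; set m := (gm t + eps)%MM.
have hcoef t' : eqmod I (restrict A (b (iota t')))@_m
    (restrict A q * 'X_[gm t'])@_m.
  rewrite hb restrictM; have idM := mcoeffs_in_ideal idI.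
  have /(_ m) := eqmodM idM (eqmod_refl idM (restrict A q))
    (chart_restrict_monomial (gm t')).
  by rewrite mcoeffB.
pose rest := \sum_(j | j != iota t) w j * (restrict A (b j))@_m.
apply: (rational_in_eqmod idI delta_poly (t := - rest)).
  have := hF t; rewrite -/m (bigD1 (iota t)) //= -/rest => hFm.
  rewrite /eqmod opprK.
  have h : eqmod I delta (restrict A (b (iota t)))@_m.
    apply: eqmod_sym => //; apply: (eqmod_trans idI (hcoef t)).
    rewrite /m mcoeffMX; exact: heps.
  have := idealD idI hFm (ideal_mull idI (w (iota t)) h).
  by congr I; ring.
rewrite -mulN1r; apply: rational_inM => //.
  by rewrite -(rmorph1 phi) -rmorphN; apply: rational_in_const.
apply: rational_in_sum => // j ne_j.
case: (boolP (j \in codom iota)) => [/codomP [t' ej]|hj]; last first.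
  by apply: rational_inM; [exact: idI | exact: hw | exact: rational_mcoeff_restrict].
case: (ltnP (om (gm t)) (om (gm t'))) => [lt_om|le_om].
  apply: rational_inM => //; last exact: rational_mcoeff_restrict.
  by rewrite ej; apply: IH; have := hB t'; move: lt_v; lia.
(* Here the coefficient of [w (iota t')] lies in [I]: either [gm t'] does not divide [m], or
   [m - gm t'] differs from [eps] and has at least its [Omega]-degree. *)
apply: rational_in_ideal; apply: ideal_mull => //; rewrite ej.
apply: (ideal_eqmod idI (hcoef t')).
case: (boolP (gm t' <= m)%MM) => [le_m|nle_m]; last first.
  rewrite (_ : _@_m = 0); first exact: ideal0.
  apply/eqP; rewrite mcoeff_eq0 (perm_mem (msuppMX _ _)); apply/mapP => -[k _ e].
  by move: nle_m; rewrite e lem_addr.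
have e_m : m = (gm t' + (m - gm t'))%MM by rewrite addmC submK.
have -> : (restrict A q * 'X_[gm t'])@_m = (restrict A q)@_(m - gm t').
  by rewrite [in LHS]e_m mcoeffMX.
apply: hother.
  apply: contraNneq ne_j => e; rewrite ej; apply/eqP; congr iota; apply: gm_inj.
  by apply: (@addIm _ eps); rewrite -/m -(submK le_m) e addmC.
have : (om (m - gm t')%MM + om (gm t') = om (gm t) + om eps)%N.
  by rewrite -!omD submK.
by rewrite -!/(om _); lia.
Qed.

End Chart.
End Restriction.

(** * Elimination in a chart of the Grassmannian *)

Section ChartElimination.
Variables (C : fieldType) (S : comNzRingType) (phi : {rmorphism C -> S}).
Variables (r n : nat) (A : 'M[S]_(r, n)) (sigma : 'I_r -> 'I_n).
Variables (I : S -> Prop) (idI : ideal I).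
Hypothesis chart : forall j j', eqmod I (A j (sigma j')) (j == j')%:R.

(** Columns outside [K] are constant modulo [I], and [#|T|] of the unknowns [w] are solved for by
    triangularity. The generators that remain, [r * #|K|] matrix entries and [#|J| - #|T|] unknowns,
    are fewer than the [#|J|] unknowns, so the latter are related. *)
Lemma chart_elimination (K : {set 'I_n}) (J T : finType) (b : J -> {mpoly C[n]})
    (w : J -> S) (gm : T -> 'X_{1..r}) (iota : T -> J) (q : {mpoly C[n]})
    (eps : 'X_{1..r}) (Omega : pred 'I_r) (delta : S) :
  (forall j i, i \notin K -> exists c, eqmod I (A j i) (phi c)) ->
  (r * #|K| < #|T|)%N ->
  delta = 1 \/ (exists j i, delta = A j i) ->
  injective gm -> injective iota ->
  (forall t, b (iota t) = q * 'X_[monomial_image sigma (gm t)]) ->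
  (forall t, I (\sum_j w j * (restrict phi A (b j))@_(gm t + eps))) ->
  eqmod I (restrict phi A q)@_eps delta ->
  (forall m, m != eps -> (\sum_(j | Omega j) eps j <= \sum_(j | Omega j) m j)%N ->
     I (restrict phi A q)@_m) ->
  exists (e : nat) (h : {mpoly C[#|J|]}),
    h != 0 /\ I (delta ^+ e * mmap phi (fun i => w (enum_val i)) h).
Proof.
move=> hK ltT hdelta gm_inj iota_inj hb hF heps hother.
pose V : finType := ('I_r * 'I_n + J)%type.
pose gen (v : V) : S := match v with inl x => A x.1 x.2 | inr j => w j end.
pose Z : {set V} :=
  (inl @: setX setT K) :|: (inr @: ~: (iota @: setT)).
pose z (i : 'I_#|Z|) := gen (enum_val i).
have ltZ : (#|Z| < #|J|)%N.
  apply: (leq_ltn_trans (leq_card_setU _ _)).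
  rewrite !card_imset; try by [move=> x y []].
  rewrite cardsX cardsT card_ord; have := cardsC (iota @: setT).
  by rewrite card_imset // cardsT; move: ltT; lia.
have genZ v : v \in Z -> exists i, gen v = z i.
  by move=> hv; exists (enum_rank_in hv v); rewrite /z enum_rankK_in.
have polyA j i : exists P : {mpoly C[#|Z|]}, eqmod I (A j i) (mmap phi z P).
  case: (boolP (i \in K)) => hi; last first.
    by have [c hc] := hK j i hi; exists c%:MP; rewrite mmapC.
  have [|l hl] := genZ (inl (j, i)).
    by rewrite inE imset_f // inE in_setT.
  by exists 'X_l; rewrite mmapX mmap1U -hl; apply: eqmod_refl.
have delta_poly : exists P : {mpoly C[#|Z|]}, eqmod I delta (mmap phi z P).
  case: hdelta => [->|[j [i ->]]]; last exact: polyA.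
  by exists 1; rewrite rmorph1; apply: eqmod_refl.
have rationalA j i : rational_in phi I z delta (A j i).
  by have [P hP] := polyA j i; exists 0%N, P; rewrite expr0 mul1r.
apply: (rational_in_relation idI delta_poly ltZ) => i.
move: (enum_val i) => {i}; apply: (rational_by_triangularity (A := A) (sigma := sigma)
  idI chart delta_poly rationalA gm_inj iota_inj hb hF heps hother).
move=> j hj; have [|l hl] := genZ (inr j).
  rewrite inE orbC imset_f // inE; apply: contra hj => /imsetP [t _ ->].
  exact: codom_f.
rewrite -[w j]/(gen (inr j)) hl; exact: rational_in_gen.
Qed.

(** Give ['X_j0] weight 0 and the other variables weight 1. The first product restricts to a linear
    form times ['X_j0], of weight at most 1, while the second becomes ['X_j1 * 'X_j2], of weight
    2. *)
Lemma quadric_leading_term (p1 p2 p3 p4 : 'I_n) (j0 j1 j2 : 'I_r) :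
  p2 = sigma j0 -> p3 = sigma j1 -> p4 = sigma j2 -> j1 != j0 -> j2 != j0 ->
  let q : {mpoly C[n]} := 'X_p1 * 'X_p2 + 'X_p3 * 'X_p4 in
  let eps := (U_(j1) + U_(j2))%MM in
  eqmod I (restrict phi A q)@_eps 1 /\
  forall m, m != eps ->
    (\sum_(j | j != j0) eps j <= \sum_(j | j != j0) m j)%N ->
    I (restrict phi A q)@_m.
Proof.
move=> -> -> -> ne1 ne2 q eps.
pose om (m : 'X_{1..r}) := (\sum_(j | j != j0) m j)%N.
have omD m m' : om (m + m')%MM = (om m + om m')%N.
  by rewrite /om -big_split /=; apply: eq_bigr => j _; rewrite mnmDE.
have om1 j : om U_(j)%MM = (j != j0).
  rewrite /om; case: (altP (j =P j0)) => [->|ne] /=.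
    by rewrite big1 // => l ne; rewrite mnm1E eq_sym (negPf ne).
  rewrite (bigD1 j) //= mnm1E eqxx big1 // => l /andP [_ ne'].
  by rewrite mnm1E eq_sym (negPf ne').
have om_eps : om eps = 2%N by rewrite omD !om1 ne1 ne2.
have idM := mcoeffs_in_ideal r idI.
pose L := linear_row A p1.
have hq : eqmod (mcoeffs_in I) (restrict phi A q) (L * 'X_j0 + 'X_[eps]).
  rewrite restrictD !restrictM !restrictX mpolyXD.
  apply: (eqmodD idM); apply: (eqmodM idM); try exact: chart_linear_row.
  exact: eqmod_refl.
have hL m : (2 <= om m)%N -> (L * 'X_j0)@_m = 0.
  move=> h; apply/eqP; rewrite mcoeff_eq0 (perm_mem (msuppMX _ _)).
  apply/mapP => -[m']; rewrite mcoeff_msupp => hm' e.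
  have [l el] : exists l, m' = U_(l)%MM.
    case: (boolP [exists l, m' == U_(l)%MM]) => [/existsP [l /eqP]|]; first by exists l.
    rewrite negb_exists => /forallP hl.
    by move: hm'; rewrite mcoeff_linear_row0 ?eqxx.
  by move: h; rewrite e el omD !om1 eqxx; case: (_ != _).
have coef m : (2 <= om m)%N -> eqmod I (restrict phi A q)@_m (m == eps)%:R.
  by move=> h; have := hq m; rewrite mcoeffB mcoeffD hL // add0r mcoeffX eq_sym.
split; first by have := coef eps; rewrite om_eps eqxx; apply.
move=> m ne; rewrite -!/(om _) om_eps => h.
by have := coef m h; rewrite (negPf ne) /eqmod subr0.
Qed.

End ChartElimination.

Lemma bounded_multinom_card (r d c : nat) : (c < d)%N ->
  ('C(c + r, c) <= #|{: {m : 'X_{1..r.+1 < d} | mdeg m == c}}|)%N.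
Proof.
move=> lt_cd; rewrite -size_basis.
pose T : finType := {m : 'X_{1..r.+1 < d} | mdeg m == c}.
rewrite cardE -(size_map (fun t : T => val (val t) : 'X_{1..r.+1})).
apply: uniq_leq_size; first exact: uniq_basis.
move=> m; rewrite -basis_cover => /eqP hm.
have hb : (mdeg m < d)%N by rewrite hm.
have ht : mdeg (BMultinom hb) == c by rewrite /= hm.
apply/mapP; exists (exist _ (BMultinom hb) ht : T) => //.
by rewrite mem_enum.
Qed.

(** * The family f_w and its chart equations *)

Definition quadric (C : fieldType) (n k : nat) : {mpoly C[n.+1]} :=
  'X_(inord k.-1) * 'X_(inord k) + 'X_(inord k.+1) * 'X_(inord k.+2).

Definition ci_generator (C : fieldType) (n k : nat) (h : 'I_k) : {mpoly C[n.+1]} :=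
  if val h == k.-1 then quadric C n k else 'X_(inord h).

Definition family_index (n d k : nat) : finType := ('I_k * 'X_{1..n.+1 < d})%type.

(* Indices of the wrong degree carry the zero polynomial. *)
Definition family_member (C : fieldType) (n d k : nat) (j : family_index n d k) :
    {mpoly C[n.+1]} :=
  if mdeg j.2 == (d - idx_1_2 k j.1)%N then ci_generator C n j.1 * 'X_[j.2] else 0.

Section ChartRelation.
Variables (C : fieldType) (d n k : nat).
Hypotheses (hd : (4 <= d)%N) (hk : (2 <= k)%N) (hn : (k + 3 <= n)%N).
Hypothesis hbin : (k * (n - k + 1) <= 'C(n - k - 2 + d, n - k))%N.
Local Notation r := (n - k).+1.
Local Notation J := (family_index n d k).

Variables (S : comNzRingType) (phi : {rmorphism C -> S}).
Variables (A : 'M[S]_(r, n.+1)) (w : J -> S) (sigma : 'I_r -> 'I_n.+1).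
Hypothesis sigma_inj : injective sigma.

(** Generators of the ideal of the incidence variety in the chart [sigma]: the coefficients of the
    restricted f_w, and the normalization of the columns [sigma] to the identity. *)
Definition chart_equation
    (u : ('X_{1..r < d.+1} + 'I_r * 'I_r)%type) : S :=
  match u with
  | inl m => \sum_j w j * (restrict phi A (family_member C j))@_m
  | inr jj => A jj.1 (sigma jj.2) - (jj.1 == jj.2)%:R
  end.

Let T c : finType := {m : 'X_{1..r < d} | mdeg m == c}.
Let gm c (t : T c) : 'X_{1..r} := val (val t).

Let gm_inj c : injective (@gm c).
Proof. by move=> t t' e; apply/val_inj/val_inj. Qed.

Let mdeg_gm c (t : T c) : mdeg (gm t) = c.
Proof. exact: (eqP (valP t)). Qed.

Let image_bound c (t : T c) : (mdeg (monomial_image sigma (gm t)) < d)%N.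
Proof. by rewrite mdeg_monomial_image bmdeg. Qed.

Let iota c (h : 'I_k) (t : T c) : J := (h, BMultinom (image_bound t)).

Let iota_inj c h : injective (@iota c h).
Proof. by move=> t t' [] /(monomial_image_inj sigma_inj) /gm_inj. Qed.

Let family_iota c (h : 'I_k) (t : T c) : c = (d - idx_1_2 k h)%N ->
  family_member C (iota h t) = ci_generator C n h * 'X_[monomial_image sigma (gm t)].
Proof. by move=> e; rewrite /family_member /= mdeg_monomial_image mdeg_gm -e eqxx. Qed.

(** The numerical hypothesis concerns degree [d - 2]; passing to degree [d - 1], Pascal's rule adds
    a positive term, which makes the inequality strict. *)
Let card_T1 : (r * k < #|T d.-1|)%N.
Proof.
apply: leq_trans (bounded_multinom_card _ _); last by lia.
have [m em] : exists m, (n - k = m.+1)%N by exists (n - k).-1; lia.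
have [c ec] : exists c, d = c.+2 by exists d.-2; lia.
move: hbin; rewrite em ec.
have -> : (m.+1 - 2 + c.+2 = c + m.+1)%N by lia.
have -> : (c.+2.-1 + m.+1 = (c + m.+1).+1)%N by lia.
rewrite -(@bin_sub (c + m.+1) m.+1) ?leq_addl // addnK /= binS.
have : (0 < 'C(c + m.+1, c.+1))%N by rewrite bin_gt0; lia.
lia.
Qed.

(** Here strictness comes from [k >= 2]. *)
Let card_T2 : (r * 1 < #|T d.-2|)%N.
Proof.
apply: leq_trans (bounded_multinom_card _ _); last by lia.
have [c ec] : exists c, d = c.+2 by exists d.-2; lia.
move: hbin; rewrite ec /=.
have -> : (n - k - 2 + c.+2 = c + (n - k))%N by lia.
rewrite -(@bin_sub (c + (n - k)) (n - k)) ?leq_addl // addnK /= => h.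
apply: leq_trans h; move: (n - k)%N => m; nia.
Qed.

Lemma linear_generator (i : 'I_k.-1) (hi : (i < k)%N) :
  ci_generator C n (Ordinal hi) = 'X_(inord i) /\ idx_1_2 k (Ordinal hi) = 1%N.
Proof. by rewrite /ci_generator /idx_1_2 /= (ltn_eqF (ltn_ord i)). Qed.

(** [span_sum_relation] glues two cases: one entry in the columns below [k.-1] is inverted, or all
    these entries are added to the ideal. *)
Lemma chart_relation :
  exists h : {mpoly C[#|J|]},
    h != 0 /\ span chart_equation (mmap phi (fun i => w (enum_val i)) h).
Proof.
pose L : finType := ('I_r * 'I_k.-1)%type.
pose a (l : L) : S := A l.1 (inord l.2).
apply: (span_sum_relation (a := a)) => [[j i]|].
  have hi : (i < k)%N by have := ltn_ord i; lia.
  have [gen_i idx_i] := linear_generator hi.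
  have idI := span_ideal chart_equation.
  pose K : {set 'I_n.+1} := ~: [set sigma j | j : 'I_r].
  have cardK : (r * #|K| < #|T d.-1|)%N.
    suff -> : #|K| = k by exact: card_T1.
    have := cardsC [set sigma j | j : 'I_r].
    rewrite card_imset // !card_ord -/K. move: (#|K|) => x /=; lia.
  have chart j1 j2 : eqmod (span chart_equation) (A j1 (sigma j2)) (j1 == j2)%:R.
    exact: (span_gen chart_equation (inr (j1, j2))).
  (* The generator is a variable: with [Omega] the single index [j], only the term ['X_j] of its
     restriction has positive [Omega]-degree, and its coefficient is the inverted entry. *)
  apply: (@chart_elimination C S phi r n.+1 A sigma _ idI chart K _ _
    (@family_member C n d k) w (@gm d.-1) (iota (Ordinal hi)) 'X_(inord i) U_(j)%MM (pred1 j)).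
  - move=> j1 i1; rewrite inE negbK => /imsetP [j2 _ ->].
    by exists (j1 == j2)%:R; rewrite rmorph_nat.
  - exact: cardK.
  - by right; exists j, (inord i).
  - exact: gm_inj.
  - exact: iota_inj.
  - by move=> t; rewrite family_iota ?gen_i ?idx_i ?subn1.
  - move=> t; have hb : (mdeg (gm t + U_(j))%MM < d.+1)%N.
      by rewrite mdegD mdeg1 mdeg_gm; lia.
    exact: (span_gen chart_equation (inl (BMultinom hb))).
  - by rewrite restrictX mcoeff_linear_row; apply: eqmod_refl.
  move=> m ne; rewrite !big_pred1_eq mnm1E eqxx => hm.
  rewrite restrictX mcoeff_linear_row0; first exact: ideal0.
  move=> l; apply/eqP => em; move: hm ne; rewrite em mnm1E.
  by case: eqP => // ->; rewrite eqxx.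
set G := fun u : _ + L => _.
have idI := span_ideal G.
have chart j1 j2 : eqmod (span G) (A j1 (sigma j2)) (j1 == j2)%:R.
  exact: (span_gen G (inl (inr (j1, j2)))).
have small j (i : 'I_n.+1) : (i < k.-1)%N -> span G (A j i).
  move=> hi; have := span_gen G (inr (j, Ordinal hi)).
  by rewrite /= /a /= inord_val.
(* A column of [sigma] below [k.-1] has an entry congruent both to 0 and to 1, so the ideal is the
   unit ideal and [h = 1] serves. *)
case: (boolP [exists j, (sigma j < k.-1)%N]) => [/existsP [j hj]|].
  exists 1; split; first exact: oner_neq0.
  rewrite rmorph1; have := idealB idI (small j _ hj) (chart j j).
  by rewrite eqxx opprB addrC subrK.
rewrite negb_exists => /forallP sigma_large.
(* Only the columns in [K] have free entries. Of the [k] columns outside [sigma], [k.-1] are those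
   below [k.-1], which leaves at most one. *)
pose K : {set 'I_n.+1} := [set i : 'I_n.+1 | (k.-1 <= i)%N && (i \notin codom sigma)].
have cardK : (#|K| <= 1)%N.
  have := cardsC [set sigma j | j : 'I_r]; rewrite card_imset // !card_ord.
  pose Q : {set 'I_n.+1} := [set i : 'I_n.+1 | (i < k.-1)%N].
  have eQ : #|Q| = k.-1.
    have hle : (k.-1 <= n.+1)%N by lia.
    rewrite (_ : Q = [set widen_ord hle i | i : 'I_k.-1]).
      by rewrite card_imset ?card_ord // => x y /(congr1 val) /= /val_inj.
    apply/setP => i; rewrite inE; apply/idP/imsetP => [h|[i' _ ->]]; last exact: (ltn_ord i').
    by exists (Ordinal h) => //; apply: val_inj.
  have eK : ~: [set sigma j | j : 'I_r] = Q :|: K.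
    apply/setP => i; rewrite !inE.
    have -> : (i \in [set sigma j | j : 'I_r]) = (i \in codom sigma).
      by apply/imsetP/codomP => [[j _ ->]|[j ->]]; exists j.
    case: (ltnP i k.-1) => //= h; apply/negP => /codomP [j ej].
    by move: (sigma_large j); rewrite -ej h.
  have -> : #|~: [set sigma j | j : 'I_r]| = (#|Q| + #|K|)%N.
    rewrite eK cardsU (_ : Q :&: K = set0) ?cards0 ?subn0 //.
    by apply/setP => i; rewrite !inE; case: ltnP.
  by rewrite eQ; lia.
have in_codom (p p' : 'I_n.+1) : (k.-1 <= p)%N -> (k.-1 <= p')%N -> p != p' ->
    p \notin codom sigma -> p' \in codom sigma.
  move=> hp hp' ne np; apply: contraTT cardK => np'; rewrite -ltnNge.
  have <- : #|[set p; p']| = 2%N by rewrite cards2 ne.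
  by apply/subset_leq_card/subsetP => x; rewrite !inE => /orP [] /eqP ->; rewrite ?hp ?hp'.
(* At most one of the four variables of the quadric lies outside [sigma]. Swapping factors and
   summands moves it to the place of [q1]; [q2] becomes the variable of weight 0. *)
have [q1 [q2 [q3 [q4 [eq_q [c2 [c3 [c4 [ne23 ne24]]]]]]]]] :
    exists q1 q2 q3 q4 : 'I_n.+1,
    quadric C n k = 'X_q1 * 'X_q2 + 'X_q3 * 'X_q4 /\ q2 \in codom sigma /\
    q3 \in codom sigma /\ q4 \in codom sigma /\ q2 != q3 /\ q2 != q4.
  have hv i : (k.-1 <= i)%N -> (i <= k.+2)%N -> (inord i : 'I_n.+1) = i :> nat.
    by move=> _ hi; rewrite inordK //; lia.
  have [v1 v2 v3 v4] : [/\ (inord k.-1 : 'I_n.+1) = k.-1 :> nat,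
      (inord k : 'I_n.+1) = k :> nat, (inord k.+1 : 'I_n.+1) = k.+1 :> nat
      & (inord k.+2 : 'I_n.+1) = k.+2 :> nat] by split; apply: hv; lia.
  rewrite /quadric; move: (inord k.-1) (inord k) (inord k.+1) (inord k.+2) v1 v2 v3 v4.
  move=> p1 p2 p3 p4 v1 v2 v3 v4.
  have cover (x y : 'I_n.+1) : (k.-1 <= x)%N -> (k.-1 <= y)%N -> x != y :> nat ->
      (x \in codom sigma) || (y \in codom sigma).
    by move=> hx hy ne; case: (boolP (x \in _)) => //= /(in_codom x y hx hy ne) ->.
  have : (p1 \in codom sigma) || (p2 \in codom sigma).
    by apply: cover; rewrite ?v1 ?v2; lia.
  have : (p3 \in codom sigma) || (p4 \in codom sigma).
    by apply: cover; rewrite ?v3 ?v4; lia.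
  have : (p3 \in codom sigma) || (p1 \in codom sigma).
    by apply: cover; rewrite ?v3 ?v1; lia.
  have : (p3 \in codom sigma) || (p2 \in codom sigma).
    by apply: cover; rewrite ?v3 ?v2; lia.
  have : (p4 \in codom sigma) || (p1 \in codom sigma).
    by apply: cover; rewrite ?v4 ?v1; lia.
  have : (p4 \in codom sigma) || (p2 \in codom sigma).
    by apply: cover; rewrite ?v4 ?v2; lia.
  case c1: (p1 \in _); case c2: (p2 \in _); case c3: (p3 \in _); case c4: (p4 \in _);
    do 6 move=> //= _;
    first [ by exists p1, p2, p3, p4; rewrite c2 c3 c4 -!val_eqE /= v2 v3 v4; do !split; lia
          | by exists p2, p1, p3, p4; rewrite c1 c3 c4 -!val_eqE /= v1 v3 v4;
               do !split; [ring | lia..]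
          | by exists p3, p4, p1, p2; rewrite c4 c1 c2 -!val_eqE /= v4 v1 v2;
               do !split; [ring | lia..]
          | by exists p4, p3, p1, p2; rewrite c3 c1 c2 -!val_eqE /= v3 v1 v2;
               do !split; [ring | lia..] ].
case/codomP: c2 ne23 ne24 => j0 e2; case/codomP: c3 => j1 e3; case/codomP: c4 => j2 e4.
rewrite e2 e3 e4 !(inj_eq sigma_inj) ![j0 == _]eq_sym => ne1 ne2.
have [lead other] := quadric_leading_term phi idI chart q1 e2 e3 e4 ne1 ne2.
have hk1 : (k.-1 < k)%N by lia.
suff [e [h [hn0 hh]]] : exists (e : nat) (h : {mpoly C[#|J|]}),
    h != 0 /\ span G (1 ^+ e * mmap phi (fun i => w (enum_val i)) h).
  by exists h; split => //; rewrite expr1n mul1r in hh.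
apply: (@chart_elimination C S phi r n.+1 A sigma _ idI chart K _ _
  (@family_member C n d k) w (@gm d.-2) (iota (Ordinal hk1)) _ _ _ 1
  _ _ _ _ _ _ _ lead other).
- move=> j i; rewrite inE negb_and negbK -ltnNge => /orP [hi|/codomP [j' ->]].
    by exists 0; rewrite rmorph0 /eqmod subr0; apply: small.
  by exists (j == j')%:R; rewrite rmorph_nat.
- by apply: leq_ltn_trans card_T2; rewrite leq_mul2l cardK orbT.
- by left.
- exact: gm_inj.
- exact: iota_inj.
- move=> t; rewrite family_iota /idx_1_2 /= ?eqxx ?subn2 //.
  by rewrite /ci_generator /= eqxx eq_q.
move=> t; have hb : (mdeg (gm t + (U_(j1) + U_(j2)))%MM < d.+1)%N.
  by rewrite !mdegD !mdeg1 mdeg_gm; lia.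
exact: (span_gen G (inl (inl (BMultinom hb)))).
Qed.

End ChartRelation.

(** * Points where a polynomial is nonzero *)

Lemma digits_inj (B n : nat) (f g : 'I_n -> nat) :
  (forall i, f i < B)%N -> (forall i, g i < B)%N ->
  (\sum_i f i * B ^ i = \sum_i g i * B ^ i)%N -> f =1 g.
Proof.
elim: n f g => [|n IH] f g hf hg; first by move=> _ [].
have B0 : (0 < B)%N by apply: leq_ltn_trans (hf ord0).
have split_sum (F : 'I_n.+1 -> nat) :
    (\sum_i F i * B ^ i = F ord0 + (\sum_(i < n) F (lift ord0 i) * B ^ i) * B)%N.
  rewrite big_ord_recl expn0 muln1 big_distrl /=; congr addn.
  by apply: eq_bigr => i _; rewrite /bump /= add1n expnSr mulnA.
rewrite !split_sum => e.
have e0 : f ord0 = g ord0.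
  by have := congr1 (modn^~ B) e; rewrite ![(_ + _ * B)%N]addnC !modnMDl !modn_small.
move: e; rewrite e0 => /addnI /eqP; rewrite eqn_pmul2r // => /eqP e.
have {}IH := IH _ _ (fun i => hf (lift ord0 i)) (fun i => hg (lift ord0 i)) e.
move=> i; case: (unliftP ord0 i) => [j ->|->] //; exact: IH.
Qed.

(* Kronecker substitution x_i := x ^ (B ^ i). *)
Lemma mpoly_nonzero_value (C : fieldType) (N : nat) (p : {mpoly C[N]}) :
  [pchar C] =i pred0 -> p != 0 -> exists v : 'I_N -> C, p.@[v] != 0.
Proof.
move=> hC pn0; pose B := (msize p).+1.
(* All exponents in [p] are below [B], so [ex] is injective on the support and no terms of [q]
   cancel. *)
pose ex (m : 'X_{1..N}) := (\sum_i m i * B ^ i)%N.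
pose q : {poly C} := \sum_(m <- msupp p) p@_m *: 'X^(ex m).
have digit m i : m \in msupp p -> (m i < B)%N.
  move=> /msize_mdeg_lt; rewrite mdegE (bigD1 i) //= /B; lia.
have qn0 : q != 0.
  have m0 := mlead_supp pn0; set m := mlead p in m0.
  apply: contraTneq m0 => q0; rewrite -mcoeff_eq0; apply/eqP.
  have := congr1 (fun q : {poly C} => q`_(ex m)) q0; rewrite coef0 coef_sum.
  case: (boolP (m \in msupp p)) => [hm|]; last by move/memN_msupp_eq0.
  rewrite (bigD1_seq m) ?msupp_uniq //= coefZ coefXn eqxx mulr1 big_seq_cond big1 ?addr0 //.
  move=> m' /andP [hm' ne]; rewrite coefZ coefXn; case: eqP => [e|_]; last by rewrite mulr0.
  case/eqP: ne; apply/mnmP; apply: (@digits_inj B); last by rewrite -/(ex _) -e.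
    by move=> i; apply: digit.
  by move=> i; apply: digit.
have [x hx] : exists x, ~~ root q x.
  (* In characteristic zero these [size q] elements are distinct, more than [q] has roots. *)
  pose s := [seq i%:R : C | i <- iota 0 (size q)].
  have us : uniq s.
    rewrite map_inj_in_uniq ?iota_uniq // => i j _ _.
    wlog le_ij : i j / (i <= j)%N.
      by move=> h; case: (leqP i j) => [|/ltnW] /h; [apply | move=> h' /esym /h'].
    move=> /esym/eqP; rewrite -subr_eq0 -natrB //.
    by move/pcharf0P: hC => ->; rewrite subn_eq0 => h; apply/eqP; rewrite eqn_leq le_ij.
  have : ~~ all (root q) s.
    apply/negP => hs; have := max_poly_roots qn0 hs us.
    by rewrite size_map size_iota ltnn.
  by rewrite -has_predC => /hasP [x _ hx]; exists x.
exists (fun i => x ^+ (B ^ i)); move: hx; rewrite /root /q horner_sum mevalE.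
suff -> : \sum_(m <- msupp p) (p@_m *: 'X^(ex m)).[x] =
  \sum_(m <- msupp p) p@_m * \prod_(i < N) (x ^+ (B ^ i)) ^+ m i by [].
apply: eq_bigr => m _; rewrite hornerZ hornerXn; congr (_ * _).
by rewrite /ex -prodrXr; apply: eq_bigr => i _; rewrite mulnC exprM.
Qed.

(** * Specializing the incidence equations at a point *)

Lemma form_coords_sum (C : fieldType) (n d : nat) (f : {mpoly C[n.+1]}) :
  f \is d.-homog -> f = \sum_(c : Mon n d) f@_(val (val c)) *: 'X_[val (val c)].
Proof.
move=> hf; apply/mpolyP => m; rewrite raddf_sum /=.
case: (eqVneq (mdeg m) d) => hm; last first.
  rewrite (dhomog_nemf_coeff hf hm) big1 // => c _; rewrite mcoeffZ mcoeffX.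
  by case: eqP => [e|_]; rewrite ?mulr0 //; move: hm; rewrite -e (eqP (valP c)) eqxx.
have hb : (mdeg m < d.+1)%N by rewrite hm.
have ht : mdeg (BMultinom hb) == d by rewrite /= hm.
rewrite (bigD1 (exist _ (BMultinom hb) ht : Mon n d)) //= mcoeffZ mcoeffX eqxx mulr1.
rewrite big1 ?addr0 // => c ne; rewrite mcoeffZ mcoeffX.
case: eqP => [e|_]; rewrite ?mulr0 //; case/eqP: ne.
by apply: val_inj; apply: val_inj.
Qed.

Lemma restrict_map (C : fieldType) (S S' : comNzRingType) (phi : {rmorphism C -> S})
    (ev : {rmorphism S -> S'}) (phi' : {rmorphism C -> S'}) (r n : nat)
    (A : 'M[S]_(r, n)) (f : {mpoly C[n]}) (m : 'X_{1..r}) :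
  (forall c, ev (phi c) = phi' c) ->
  ev (restrict phi A f)@_m = (restrict phi' (map_mx ev A) f)@_m.
Proof.
move=> h; rewrite -mcoeff_map_mpoly; congr (_@_m).
rewrite /restrict /mmap rmorph_sum; apply: eq_bigr => k _ /=.
rewrite rmorphM /= map_mpolyC -h; congr (_ * _).
rewrite /mmap1 rmorph_prod.
apply: eq_bigr => i _; rewrite rmorphXn /= rmorph_sum; congr (_ ^+ _).
by apply: eq_bigr => j _; rewrite /= map_mpolyZ map_mpolyX mxE.
Qed.

Section ChartFunctional.
Variables (C : fieldType) (d n k : nat).
Local Notation r := (n - k).+1.
Local Notation J := (family_index n d k).
Let V : finType := ('I_r * 'I_n.+1 + J)%type.

Definition chart_point (w0 : J -> C) (a : 'M[C]_(r, n.+1)) (i : 'I_#|V|) : C :=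
  match enum_val i with inl x => a x.1 x.2 | inr j => w0 j end.

Definition generic_matrix : 'M[{mpoly C[#|V|]}]_(r, n.+1) :=
  \matrix_(j, i) 'X_(enum_rank (inl (j, i) : V)).

Definition generic_coordinates (j : J) : {mpoly C[#|V|]} := 'X_(enum_rank (inr j : V)).

Definition family_polynomial (w0 : J -> C) : {mpoly C[n.+1]} :=
  \sum_j w0 j *: family_member C j.

Local Notation ev w0 a := (meval (chart_point w0 a)).

Lemma eval_generic_coordinates w0 a j : ev w0 a (generic_coordinates j) = w0 j.
Proof. by rewrite mevalXU /chart_point enum_rankK. Qed.

Lemma eval_generic_matrix w0 a : map_mx (ev w0 a) generic_matrix = a.
Proof. by apply/matrixP => j i; rewrite !mxE mevalXU /chart_point enum_rankK. Qed.

Lemma eval_restrict w0 a f m :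
  ev w0 a (restrict (@mpolyC _ C) generic_matrix f)@_m = (restrict idfun a f)@_m.
Proof.
by rewrite (restrict_map (phi' := idfun)) ?eval_generic_matrix // => c; exact: mevalC.
Qed.

(** At [w = w0] the relation writes the nonzero constant [h0] as a combination of the coefficients
    of f_w0 on the row space of [a], since the normalization equations vanish on the chart. The
    multipliers, frozen at [w0] and divided by [h0], define a linear functional on forms, polynomial
    in [a], that reads only the coefficients of the restriction. *)
Lemma chart_functional (sigma : 'I_r -> 'I_n.+1) (h : {mpoly C[#|J|]}) (w0 : J -> C) :
  span (chart_equation (@mpolyC _ C) generic_matrix generic_coordinates sigma)
    (mmap (@mpolyC _ C) (fun i => generic_coordinates (enum_val i)) h) ->
  h.@[fun i => w0 (enum_val i)] != 0 -> family_polynomial w0 \is d.-homog ->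
  exists P : Mon n d -> {mpoly C[#|V|]}, forall a : 'M[C]_(r, n.+1),
    (forall j j', a j (sigma j') = (j == j')%:R) ->
    \sum_c (family_polynomial w0)@_(val (val c)) * (P c).@[chart_point w0 a] = 1 /\
    forall f, f \is d.-homog -> restrict idfun a f = 0 ->
      \sum_c f@_(val (val c)) * (P c).@[chart_point w0 a] = 0.
Proof.
case=> cf hcf hw0 hom0; set h0 := h.@[_] in hw0.
exists (fun c => h0^-1 *: \sum_(m : 'X_{1..r < d.+1}) cf (inl m) *
  (restrict (@mpolyC _ C) generic_matrix 'X_[val (val c)])@_m) => a ha.
have lin f : f \is d.-homog ->
    \sum_(c : Mon n d) f@_(val (val c)) * ev w0 a (h0^-1 *:
      \sum_(m : 'X_{1..r < d.+1}) cf (inl m) *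
        (restrict (@mpolyC _ C) generic_matrix 'X_[val (val c)])@_m) =
    h0^-1 * \sum_(m : 'X_{1..r < d.+1})
      ev w0 a (cf (inl m)) * (restrict idfun a f)@_m.
  move=> hf; rewrite mulr_sumr.
  under eq_bigr => c _ do rewrite mevalZ mulrCA rmorph_sum !mulr_sumr.
  rewrite exchange_big /=; apply: eq_bigr => m _.
  rewrite [in RHS](form_coords_sum hf) restrict_sum raddf_sum !mulr_sumr.
  apply: eq_bigr => c _; rewrite rmorphM /= eval_restrict restrictZ mcoeffZ /=.
  by congr (_ * _); rewrite mulrCA.
split=> [|f hf f0]; rewrite lin //; last first.
  by rewrite f0 big1 ?mulr0 // => m _; rewrite mcoeff0 mulr0.
suff <- : h0 = \sum_(m : 'X_{1..r < d.+1}) ev w0 a (cf (inl m)) *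
    (restrict idfun a (family_polynomial w0))@_m by rewrite mulVf.
have := congr1 (ev w0 a) hcf.
have -> : ev w0 a (mmap (@mpolyC _ C) (fun i => generic_coordinates (enum_val i)) h) = h0.
  have -> : mmap (@mpolyC #|V| C) (fun i => generic_coordinates (enum_val i)) h =
      \sum_(m <- msupp h) (h@_m)%:MP *
        mmap1 (fun i => generic_coordinates (enum_val i)) m by [].
  rewrite rmorph_sum /h0 mevalE.
  apply: eq_bigr => m _; rewrite rmorphM /= mevalC /mmap1 rmorph_prod; congr (_ * _).
  by apply: eq_bigr => i _; rewrite rmorphXn /= eval_generic_coordinates.
move=> ->; rewrite rmorph_sum big_sumType /= [X in _ + X]big1 ?addr0; last first.
  move=> [j j'] _; rewrite rmorphM rmorphB /= rmorph_nat.
  by rewrite mxE mevalXU /chart_point enum_rankK /= ha subrr mulr0.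
apply: eq_bigr => m _; rewrite rmorphM rmorph_sum /=; congr (_ * _).
rewrite /family_polynomial restrict_sum raddf_sum; apply: eq_bigr => j _ /=.
by rewrite rmorphM /= eval_generic_coordinates eval_restrict restrictZ mcoeffZ.
Qed.

End ChartFunctional.

(** * Pluecker coordinates and the determinant *)

Section ProjectiveElimination.
Variables (C : fieldType) (r N : nat).
Local Notation T := {ffun 'I_r -> 'I_N}.

(** The index [sigma] ranges over all maps, so that replacing one column in Cramer's rule gives
    another minor without reordering or sign. *)
Definition minor (sigma : T) (Y : 'M[C]_(r, N)) : C := \det (colsub sigma Y).

Definition minors (Y : 'M[C]_(r, N)) (i : 'I_#|T|) : C := minor (enum_val i) Y.

Definition chart_matrix (sigma : T) (Y : 'M[C]_(r, N)) : 'M[C]_(r, N) :=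
  invmx (colsub sigma Y) *m Y.

Lemma chart_matrix_chart sigma Y j j' :
  minor sigma Y != 0 -> chart_matrix sigma Y j (sigma j') = (j == j')%:R.
Proof.
move=> h; have u : colsub sigma Y \in unitmx by rewrite unitmxE unitfE.
have := congr1 (fun M : 'M_r => M j j') (mulVmx u); rewrite !mxE => <-.
by apply: eq_bigr => l _; rewrite mxE.
Qed.

Lemma minor_non_injective (sigma : T) Y : ~ injective sigma -> minor sigma Y = 0.
Proof.
move=> /injectiveP /injectivePn [j [j' ne e]].
rewrite /minor -det_tr; apply: (determinant_alternate ne) => l.
by rewrite !mxE e.
Qed.

(* Cramer's rule. *)
Lemma chart_matrix_entry sigma Y j i : minor sigma Y != 0 ->
  minor sigma Y * chart_matrix sigma Y j i =
  minor [ffun l => if l == j then i else sigma l] Y.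
Proof.
move=> h; have u : colsub sigma Y \in unitmx by rewrite unitmxE unitfE.
rewrite /chart_matrix /invmx u -scalemxAl mxE mulrA mulfV // mul1r mxE.
rewrite /minor (expand_det_col _ j); apply: eq_bigr => l _.
rewrite !mxE ffunE eqxx mulrC; congr (_ * _); rewrite /cofactor; congr (_ * \det _).
by apply/matrixP => x y; rewrite !mxE ffunE eq_sym (negPf (neq_lift _ _)).
Qed.

(** The function on the chart is a form in the Pluecker coordinates divided by a power of the
    coordinate [sigma], of the same degree. *)
Definition homogenizable (sigma : T) (g : 'M[C]_(r, N) -> C) : Prop :=
  exists (D : nat) (Q : {mpoly C[#|T|]}), Q \is D.-homog /\
    forall Y, minor sigma Y != 0 ->
      minor sigma Y ^+ D * g (chart_matrix sigma Y) = Q.@[minors Y].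

Lemma minors_rank sigma Y : minors Y (enum_rank sigma) = minor sigma Y.
Proof. by rewrite /minors enum_rankK. Qed.

Lemma dhomogXU (L : nat) (i : 'I_L) : ('X_i : {mpoly C[L]}) \is 1.-homog.
Proof. by rewrite dhomogX; apply/eqP; exact: mdeg1. Qed.

Lemma dhomogXUn (L : nat) (i : 'I_L) e : ('X_i ^+ e : {mpoly C[L]}) \is e.-homog.
Proof. by have := dhomogMn e (dhomogXU i); rewrite mul1n. Qed.

Lemma homogenizable_const sigma c : homogenizable sigma (fun=> c).
Proof.
exists 0%N, c%:MP; split; last by move=> Y _; rewrite expr0 mul1r mevalC.
by rewrite -alg_mpolyC; apply/dhomogZ/dhomog1.
Qed.

Lemma homogenizable_entry sigma j i : homogenizable sigma (fun a => a j i).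
Proof.
exists 1%N, 'X_(enum_rank ([ffun l => if l == j then i else sigma l] : T)).
split; first exact: dhomogXU.
by move=> Y h; rewrite mevalXU expr1 minors_rank chart_matrix_entry.
Qed.

Lemma homogenizableD sigma g g' : homogenizable sigma g -> homogenizable sigma g' ->
  homogenizable sigma (fun a => g a + g' a).
Proof.
move=> [D [Q [hQ eQ]]] [D' [Q' [hQ' eQ']]]; pose x : {mpoly C[#|T|]} := 'X_(enum_rank sigma).
exists (D + D')%N, (x ^+ D' * Q + x ^+ D * Q'); split.
  apply: dhomogD; last by apply: dhomogM => //; apply: dhomogXUn.
  by rewrite addnC; apply: dhomogM => //; apply: dhomogXUn.
move=> Y h; rewrite mevalD !mevalM !rmorphXn /= !mevalXU minors_rank -eQ // -eQ' //.
by rewrite exprD; ring.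
Qed.

Lemma homogenizableM sigma g g' : homogenizable sigma g -> homogenizable sigma g' ->
  homogenizable sigma (fun a => g a * g' a).
Proof.
move=> [D [Q [hQ eQ]]] [D' [Q' [hQ' eQ']]].
exists (D + D')%N, (Q * Q'); split; first exact: dhomogM.
by move=> Y h; rewrite mevalM -eQ // -eQ' // exprD; ring.
Qed.

Lemma homogenizable_ext sigma g g' : g =1 g' -> homogenizable sigma g ->
  homogenizable sigma g'.
Proof. by move=> e [D [Q [hQ eQ]]]; exists D, Q; split=> // Y h; rewrite -e eQ. Qed.

Lemma homogenizable_poly sigma (L : nat) (v : 'M[C]_(r, N) -> 'I_L -> C) (P : {mpoly C[L]}) :
  (forall i, homogenizable sigma (v^~ i)) -> homogenizable sigma (fun a => P.@[v a]).
Proof.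
move=> hv; apply: (homogenizable_ext
  (g := fun a => \sum_(m <- msupp P) P@_m * \prod_i v a i ^+ m i)).
  by move=> a; rewrite mevalE.
elim: (msupp P) => [|m s IH].
  by apply: (homogenizable_ext (g := fun=> 0)) (homogenizable_const _ _) => a;
    rewrite big_nil.
apply: (homogenizable_ext (g := fun a => P@_m * \prod_i v a i ^+ m i +
  \sum_(m <- s) P@_m * \prod_i v a i ^+ m i)); first by move=> a; rewrite big_cons.
apply: homogenizableD IH; apply: homogenizableM; first exact: homogenizable_const.
elim: (index_enum _) => [|i {}s IH].
  by apply: (homogenizable_ext (g := fun=> 1)) (homogenizable_const _ _) => a;
    rewrite big_nil.
apply: (homogenizable_ext (g := fun a => v a i ^+ m i * \prod_(i <- s) v a i ^+ m i)).
  by move=> a; rewrite big_cons.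
apply: homogenizableM IH; elim: (m i) => [|e IH].
  by apply: (homogenizable_ext (g := fun=> 1)) (homogenizable_const _ _) => a;
    rewrite expr0.
by apply: homogenizable_ext (homogenizableM (hv i) IH) => a; rewrite exprS.
Qed.

Lemma dhomog_det (L e : nat) (M : 'M[{mpoly C[L]}]_e) :
  (forall i j, M i j \is 1.-homog) -> \det M \is e.-homog.
Proof.
move=> hM; rewrite /determinant; apply: rpred_sum => s _.
rewrite -signr_odd mulr_sign; set p := \prod_i _.
suff hp : p \is e.-homog by case: ifP => _ //; rewrite rpredN.
have h l (F : 'I_l -> {mpoly C[L]}) : (forall i, F i \is 1.-homog) ->
    \prod_i F i \is l.-homog.
  elim: l F => [|l IH] F hF; first by rewrite big_ord0 dhomog1.
  by rewrite big_ord_recl; apply: (@dhomogM _ _ _ 1%N _ l) => //; apply: IH.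
by apply: h => i; apply: hM.
Qed.

(** The value 0 outside degree [D] lets vectors of degree [D] monomials be indexed by the finite
    type of monomials of degree at most [D]. *)
Definition monomial_value (L D : nat) (p : 'I_L -> C) (m : 'X_{1..L}) : C :=
  if mdeg m == D then \prod_i p i ^+ m i else 0.

Lemma dhomog_eval (L D : nat) (Q : {mpoly C[L]}) (p : 'I_L -> C) : Q \is D.-homog ->
  Q.@[p] = \sum_(m : 'X_{1..L < D.+1}) Q@_m * monomial_value D p m.
Proof.
move=> hQ; have hs : (msize Q <= D.+1)%N.
  rewrite msizeE; apply/bigmax_leqP_seq => m hm _.
  by rewrite (dhomog_mf hQ).
rewrite {1}(mpolywE hs) rmorph_sum; apply: eq_bigr => m _ /=.
rewrite mevalZ mevalX /monomial_value; case: eqP => // ne.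
by rewrite (dhomog_nemf_coeff hQ) ?mul0r //; apply/eqP.
Qed.

(* The monomials of high degree in the Pluecker coordinates p satisfy a linear
   system with matrix t I - M(t f0 - g), t = g c0 / f0 c0. *)
Lemma projective_elimination (X : finType) (f0 : X -> C) (c0 : X)
    (bad : (X -> C) -> 'M[C]_(r, N) -> Prop) :
  f0 c0 != 0 ->
  (forall sigma : T, exists Lam : X -> 'M[C]_(r, N) -> C,
    (forall c, homogenizable sigma (Lam c)) /\
    forall Y, minor sigma Y != 0 ->
      \sum_c f0 c * Lam c (chart_matrix sigma Y) = 1 /\
      forall g, bad g Y -> \sum_c g c * Lam c (chart_matrix sigma Y) = 0) ->
  exists (e : nat) (Q : {mpoly C[#|X|]}),
    [/\ Q \is e.-homog, Q.@[fun i => f0 (enum_val i)] != 0 &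
    forall g Y, bad g Y -> (exists sigma, minor sigma Y != 0) ->
      Q.@[fun i => g (enum_val i)] = 0].
Proof.
move=> f00 /fin_all_exists [Lam hLam].
have /fin_all_exists [D0 /fin_all_exists [Q0 hQ0]] (x : T * X) :
    exists (D : nat) (Q : {mpoly C[#|T|]}), Q \is D.-homog /\
    forall Y, minor x.1 Y != 0 ->
      minor x.1 Y ^+ D * Lam x.1 x.2 (chart_matrix x.1 Y) = Q.@[minors Y].
  by have [h _] := hLam x.1; exact: h.
(* Strictly larger than every [D0 x], so that [G] keeps a positive power of the minor and vanishes
   wherever the minor does. *)
pose D := (\sum_x D0 x).+1.
have leD x : (D0 x < D)%N by rewrite ltnS (bigD1 x) //= leq_addr.
pose G (sigma : T) (c : X) : {mpoly C[#|T|]} :=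
  'X_(enum_rank sigma) ^+ (D - D0 (sigma, c)) * Q0 (sigma, c).
have homG sigma c : G sigma c \is D.-homog.
  rewrite -{1}(subnK (ltnW (leD (sigma, c)))); apply: dhomogM; first exact: dhomogXUn.
  by have [] := hQ0 (sigma, c).
have evG sigma c Y : minor sigma Y != 0 ->
    (G sigma c).@[minors Y] = minor sigma Y ^+ D * Lam sigma c (chart_matrix sigma Y).
  move=> h; have [_ hQ] := hQ0 (sigma, c).
  rewrite mevalM rmorphXn /= mevalXU minors_rank -hQ // mulrA -exprD.
  by rewrite subnK // ltnW.
have evG0 sigma c Y : minor sigma Y = 0 -> (G sigma c).@[minors Y] = 0.
  move=> h; rewrite mevalM rmorphXn /= mevalXU minors_rank h expr0n.
  by rewrite subn_eq0 leqNgt leD mul0r.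
(* The functional [Lam sigma] is 1 at [f0] and 0 at [g], hence [t] at [t f0 - g]; this is multiplied
   by the [D]-th power of the minor. *)
have rel sigma g Y : bad g Y -> let t := g c0 / f0 c0 in
    t * minor sigma Y ^+ D = \sum_c (t * f0 c - g c) * (G sigma c).@[minors Y].
  move=> hg t; case: (eqVneq (minor sigma Y) 0) => [h0|hn].
    by rewrite h0 expr0n mulr0 big1 // => c _; rewrite evG0 ?mulr0.
  have [_ /(_ Y hn) [h1 /(_ g hg) h2]] := hLam sigma.
  transitivity (minor sigma Y ^+ D *
      (t * \sum_c f0 c * Lam sigma c (chart_matrix sigma Y) -
       \sum_c g c * Lam sigma c (chart_matrix sigma Y))).
    by rewrite h1 h2 mulr1 subr0 mulrC.
  rewrite mulr_sumr -sumrB mulr_sumr; apply: eq_bigr => c _.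
  rewrite evG //; move: (_ ^+ D) (Lam _ _ _) => u v; ring.
(* In this degree every monomial has, by pigeonhole, an exponent at least [D]; [rel] rewrites that
   power of a Pluecker coordinate. *)
pose D' := (#|T| * D)%N.
pose B : finType := 'X_{1..#|T| < D'.+1}.
pose Rw (m : 'X_{1..#|T|}) (c : X) : {mpoly C[#|T|]} :=
  if mdeg m == D' then
    if [pick i | (D <= m i)%N] is Some i
    then 'X_[m - U_(i) *+ D] * G (enum_val i) c else 0
  else 0.
have le_U (m : 'X_{1..#|T|}) i : (D <= m i)%N -> (U_(i) *+ D <= m)%MM.
  move=> h; apply/mnm_lepP => l; rewrite mulmnE mnm1E.
  by case: eqP => [<-|_]; rewrite ?mul1n.
have homR m c : Rw m c \is D'.-homog.
  rewrite /Rw; case: eqP => [hm|_]; last exact: rpred0.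
  case: pickP => [i hi|_]; last exact: rpred0.
  have e : (mdeg (m - U_(i) *+ D)%MM + D = D')%N.
    have := congr1 (@mdeg _) (submK (le_U m i hi)).
    by rewrite mdegD mdegMn mdeg1 mul1n hm.
  by rewrite -e; apply: dhomogM => //; rewrite dhomogX.
have relR m g Y : bad g Y -> (exists sigma, minor sigma Y != 0) ->
    let t := g c0 / f0 c0 in
    t * monomial_value D' (minors Y) m =
    \sum_c (t * f0 c - g c) * (Rw m c).@[minors Y].
  move=> hg [sigma0 _] t; rewrite /monomial_value /Rw; case: eqP => [hm|_]; last first.
    by rewrite mulr0 big1 // => c _; rewrite meval0 mulr0.
  case: pickP => [i hi|hno]; last first.
    have T0 : (0 < #|T|)%N by apply/card_gt0P; exists sigma0.
    have : (mdeg m <= \sum_(i < #|T|) D.-1)%N.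
      rewrite mdegE; apply: leq_sum => i _; have := hno i.
      by rewrite /D /= leqNgt => /negbFE; rewrite ltnS.
    rewrite sum_nat_const card_ord hm /D' leq_mul2l.
    by rewrite (negPf (lt0n_neq0 T0)) //= /D ltnn.
  transitivity (t * minor (enum_val i) Y ^+ D * ('X_[m - U_(i) *+ D]).@[minors Y]).
    rewrite -mulrA; congr (_ * _); rewrite -mevalX -[in LHS](submK (le_U m i hi)).
    by rewrite mpolyXD mevalM mulrC -mpolyXn rmorphXn /= mevalXU.
  rewrite (rel _ g Y hg) mulr_suml; apply: eq_bigr => c _.
  by rewrite [in RHS]mevalM -mulrA; congr (_ * _); apply: mulrC.
pose tp : {mpoly C[#|X|]} := (f0 c0)^-1 *: 'X_(enum_rank c0).
(* Column [i] holds the relation for the [i]-th monomial, since the kernel vector below multiplies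
   from the left. *)
pose M : 'M[{mpoly C[#|X|]}]_#|B| := \matrix_(j, i)
  (tp *+ (i == j) - \sum_c (f0 c *: tp - 'X_(enum_rank c)) *
     ((Rw (val (enum_val i)) c)@_(val (enum_val j)))%:MP).
have homt : tp \is 1.-homog by apply: dhomogZ; apply: dhomogXU.
have evM g j i : (M j i).@[fun l => g (enum_val l)] =
    let t := g c0 / f0 c0 in
    t *+ (i == j) - \sum_c (t * f0 c - g c) * (Rw (val (enum_val i)) c)@_(val (enum_val j)).
  have evt : tp.@[fun l => g (enum_val l)] = g c0 / f0 c0.
    by rewrite mevalZ mevalXU enum_rankK mulrC.
  rewrite mxE mevalB mevalMn evt rmorph_sum /=; congr (_ - _).
  apply: eq_bigr => c _; rewrite mevalM mevalB mevalZ evt mevalXU enum_rankK mevalC.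
  by rewrite [f0 c * _]mulrC.
have ev_det g : (\det M).@[fun l => g (enum_val l)] =
    \det (map_mx (meval (fun l => g (enum_val l))) M) by rewrite det_map_mx.
exists #|B|, (\det M); split.
- apply: dhomog_det => j i; rewrite mxE; apply: rpredB; first exact: rpredMn.
  apply: rpred_sum => c _; rewrite mulrC mul_mpolyC; apply: dhomogZ.
  by apply: rpredB; [apply: dhomogZ | apply: dhomogXU].
- rewrite ev_det (_ : map_mx _ _ = 1%:M) ?det1 ?oner_eq0 //.
  apply/matrixP => j i; rewrite [RHS]mxE mxE evM /= divff // eq_sym big1 ?subr0 //.
  by move=> c _; rewrite mul1r subrr mul0r.
move=> g Y hg hY; rewrite ev_det; apply/eqP/det0P.
(* The monomials of degree [D'] at the Pluecker coordinates of [Y]; the power of a nonzero minor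
   shows that this vector is nonzero. *)
exists (\row_i monomial_value D' (minors Y) (val (enum_val i))).
  case: hY => sigma hs; apply/rV0Pn.
  have hm : (mdeg (U_(enum_rank sigma) *+ D')%MM < D'.+1)%N.
    by rewrite mdegMn mdeg1 mul1n.
  exists (enum_rank (BMultinom hm : B)); rewrite mxE enum_rankK /monomial_value /=.
  rewrite mdegMn mdeg1 mul1n eqxx; apply/prodf_neq0 => i _.
  rewrite mulmnE mnm1E; have [<-|_] := eqVneq (enum_rank sigma) i; last first.
    by rewrite mul0n expr0 oner_eq0.
  by rewrite minors_rank expf_neq0.
apply/rowP => i; rewrite !mxE.
under eq_bigr => j _ do rewrite mxE [X in _ * X]mxE evM /= mulrBr.
rewrite sumrB (bigD1 i) //= eqxx mulr1n mulrC big1 ?addr0; last first.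
  by move=> j ne; rewrite eq_sym (negPf ne) mulr0n mulr0.
rewrite (relR _ g Y hg hY).
apply/eqP; rewrite subr_eq0; apply/eqP.
under [RHS]eq_bigr => j _ do rewrite mulr_sumr.
rewrite exchange_big /=; apply: eq_bigr => c _.
rewrite (dhomog_eval _ (homR _ _)) mulr_sumr.
rewrite (reindex (fun i : 'I_#|B| => enum_val i)) /=; last first.
  by exists enum_rank => x _; rewrite ?enum_valK ?enum_rankK.
by apply: eq_bigr => j _; rewrite [in RHS]mulrCA; congr (_ * _); apply: mulrC.
Qed.

End ProjectiveElimination.

(** * Linear subspaces and complete intersections *)

Section LinearSubspace.
Variables (C : fieldType) (n d : nat).

Lemma restrict_linear_form (r : nat) (a : 'M[C]_(r, n.+1)) (f : {mpoly C[n.+1]}) :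
  f \is 1.-homog -> (forall j, \sum_i f@_U_(i) * a j i = 0) ->
  restrict idfun a f = 0.
Proof.
move=> hf ha; have -> : f = \sum_i f@_U_(i) *: 'X_i.
  apply/mpolyP => m; rewrite raddf_sum /=.
  case: (boolP (mdeg m == 1%N)) => [/mdeg1P [i /eqP ->]|hm].
    rewrite (bigD1 i) //= mcoeffZ mcoeffXU eqxx mulr1 big1 ?addr0 // => l ne.
    by rewrite mcoeffZ mcoeffXU (negPf ne) mulr0.
  rewrite (dhomog_nemf_coeff hf hm) big1 // => i _; rewrite mcoeffZ mcoeffX.
  by case: eqP => [e|_]; rewrite ?mulr0 //; move: hm; rewrite -e mdeg1 eqxx.
rewrite restrict_sum.
transitivity (\sum_i \sum_j (f@_U_(i) * a j i) *: ('X_j : {mpoly C[r]})).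
  apply: eq_bigr => i _; rewrite restrictZ restrictX /linear_row scaler_sumr.
  by apply: eq_bigr => j _; rewrite scalerA.
rewrite exchange_big big1 // => j _ /=.
by rewrite -scaler_suml ha scale0r.
Qed.

Lemma row_free_rowsub (p q m : nat) (f : 'I_p -> 'I_q) (B : 'M[C]_(q, m)) :
  injective f -> row_free B -> row_free (rowsub f B).
Proof.
move=> inj /row_freeP [B' hB]; apply/row_freeP; exists (colsub f B').
have -> : rowsub f B *m colsub f B' = mxsub f f (B *m B').
  by apply/matrixP => i j; rewrite !mxE; apply: eq_bigr => l _; rewrite !mxE.
by rewrite hB; apply/matrixP => i j; rewrite !mxE (inj_eq inj).
Qed.

(** The common kernel of the [s <= k] linear forms has dimension at least [n - k + 1]; the rows of
    [Y] are that many independent vectors in it. Each [fs h], hence each summand of [p], restricts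
    to zero. *)
Lemma linear_subspace (k s : nat) (fs gs : 'I_s -> {mpoly C[n.+1]}) (p : {mpoly C[n.+1]}) :
  (s <= k)%N -> (k <= n)%N -> decomp d (idx_ones s) fs gs p ->
  exists Y : 'M[C]_((n - k).+1, n.+1),
    (exists sigma, minor sigma Y != 0) /\
    forall sigma, minor sigma Y != 0 -> restrict idfun (chart_matrix sigma Y) p = 0.
Proof.
move=> le_sk le_kn [hfg ep].
pose c : 'M[C]_(n.+1, s) := \matrix_(i, h) (fs h)@_U_(i).
pose B := row_base (kermx c).
have le_r : ((n - k).+1 <= \rank (kermx c))%N.
  by rewrite mxrank_ker; have := rank_leq_col c; lia.
pose Y := rowsub (widen_ord le_r) B; exists Y.
have freeY : row_free Y.
  apply: row_free_rowsub; last exact: row_base_free.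
  by move=> x y /(congr1 val) /= /val_inj.
have Yc : Y *m c = 0.
  have : B *m c = 0 by apply/sub_kermxP; rewrite eq_row_base.
  by move=> h; rewrite /Y mul_rowsub_mx h; apply/matrixP => i j; rewrite !mxE.
split.
  have full : row_full Y^T by rewrite /row_full mxrank_tr.
  exists (fullrankfun full); have := fullrowsub_unit full.
  rewrite unitmxE unitfE -det_tr; congr (\det _ != 0).
  by apply/matrixP => i j; rewrite !mxE.
move=> sigma _; rewrite ep restrict_sum big1 // => h _; rewrite restrictM.
rewrite (@restrict_linear_form _ _ (fs h)) ?mul0r //; first by case: (hfg h).
move=> j; have : chart_matrix sigma Y *m c = 0 by rewrite /chart_matrix -mulmxA Yc mulmx0.
move/matrixP => /(_ j h); rewrite [LHS]mxE [RHS]mxE => e; apply: etrans e.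
by apply: eq_bigr => i _; rewrite [c i h]mxE mulrC.
Qed.

End LinearSubspace.

Section CompleteIntersection.
Variables (C : fieldType) (n k : nat).
Hypotheses (hk : (2 <= k)%N) (hn : (k + 3 <= n)%N).
Local Notation gens := (@ci_generator C n k).

(** For [j <= k.-1] the first [j] generators are variables and their ideal is the kernel of this
    map, so membership becomes an equation in a domain. *)
Definition kill_variables (j : nat) : {mpoly C[n.+1]} -> {mpoly C[n.+1]} :=
  mmap (@mpolyC n.+1 C) (fun i : 'I_n.+1 => if (i < j)%N then 0 else 'X_i).

Lemma kill_variablesX j i :
  kill_variables j 'X_i = if (i < j)%N then 0 else 'X_i.
Proof. by rewrite /kill_variables mmapX mmap1U. Qed.

Lemma in_ideal_first_ideal j : ideal (in_ideal_first j gens).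
Proof.
split.
- by exists (fun=> 0); rewrite big1 // => l _; rewrite mul0r.
- move=> x y [a ->] [b ->]; exists (fun l => a l + b l).
  by rewrite -big_split; apply: eq_bigr => l _; rewrite mulrDl.
- move=> x y [a ->]; exists (fun l => x * a l).
  by rewrite mulr_sumr; apply: eq_bigr => l _; rewrite mulrA.
Qed.

Lemma linear_ci_generator (l : 'I_k) (hl : (l < k.-1)%N) : gens l = 'X_(inord l).
Proof. by rewrite /ci_generator (ltn_eqF hl). Qed.

Lemma in_ideal_first_kill j p : (j <= k.-1)%N ->
  in_ideal_first j gens p <-> kill_variables j p = 0.
Proof.
move=> hj; have idI := in_ideal_first_ideal j; split.
  case=> a ->; rewrite /kill_variables rmorph_sum big1 // => l hl.
  have hl1 : (l < k.-1)%N by apply: leq_trans hj.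
  rewrite rmorphM /= linear_ci_generator // -/(kill_variables j 'X_(inord l)) kill_variablesX.
  have -> : (inord l : 'I_n.+1) = l :> nat by rewrite inordK //; lia.
  by rewrite hl mulr0.
suff h : eqmod (in_ideal_first j gens) p (kill_variables j p).
  by move=> h0; apply: (ideal_eqmod idI h); rewrite h0; apply: ideal0.
rewrite {1}[p]mpolyE /kill_variables /mmap; apply: eqmod_sumr => // m _.
rewrite -mul_mpolyC; apply: eqmodM => //; first exact: eqmod_refl.
rewrite mpolyXE_id /mmap1; apply: eqmod_prodr => // i _; apply: eqmodX => //.
case: ltnP => [hi|_]; last exact: eqmod_refl.
have hik : (i < k)%N by lia.
exists (fun l => (l == Ordinal hik)%:R); rewrite subr0 (bigD1 (Ordinal hik)) //=.
rewrite eqxx mul1r linear_ci_generator /=; last by lia.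
rewrite inord_val big1 ?addr0 // => l /andP [_ /negPf ->].
by rewrite mul0r.
Qed.

Lemma quadric_neq0 : quadric C n k != 0.
Proof.
pose v (i : 'I_n.+1) : C := ((i == k.-1 :> nat) || (i == k :> nat))%:R.
suff : (quadric C n k).@[v] != 0 by apply: contraNneq => ->; rewrite meval0.
have vi i : (i <= k.+2)%N -> (inord i : 'I_n.+1) = i :> nat.
  by move=> hi; rewrite inordK //; lia.
rewrite /quadric mevalD !mevalM !mevalXU /v !vi; try by lia.
have -> : (k.+1 == k.-1) || (k.+1 == k) = false by lia.
by rewrite !eqxx orbT mul0r addr0 mulr1 oner_neq0.
Qed.

(** Each partial ideal is the kernel of a map into a domain, hence prime, so it is enough that
    [gens j] lies outside it. *)
Lemma ci_generator_regular : regular_seq gens.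
Proof.
split.
  (* All generators vanish at the origin. *)
  case=> a /(congr1 (meval (fun=> 0))); rewrite meval1 rmorph_sum big1.
    by move/eqP; rewrite oner_eq0.
  move=> l _; rewrite rmorphM /= /ci_generator /quadric.
  by case: ifP => _; rewrite ?mevalD ?mevalM !mevalXU !(mulr0, addr0).
move=> j g; have hj : (j <= k.-1)%N by have := ltn_ord j; lia.
rewrite !in_ideal_first_kill // {1}/kill_variables rmorphM /= -!/(kill_variables j _).
move/eqP; rewrite mulf_eq0 => /orP [/eqP //|]; move/eqP.
suff : kill_variables j (gens j) != 0 by move=> /eqP.
have vi i : (i <= k.+2)%N -> (inord i : 'I_n.+1) = i :> nat.
  by move=> hi; rewrite inordK //; lia.
rewrite /ci_generator; have [ej|_] := eqVneq (val j) k.-1.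
  suff -> : kill_variables j (quadric C n k) = quadric C n k by exact: quadric_neq0.
  rewrite /quadric {1}/kill_variables rmorphD !rmorphM /= -!/(kill_variables j _).
  rewrite !kill_variablesX !vi; try by lia.
  by rewrite !ifN // -leqNgt [X in (X <= _)%N]ej; lia.
rewrite kill_variablesX vi; last by lia.
by rewrite ltnn -msize_poly_eq0 msizeX.
Qed.

Variable d : nat.
Hypothesis hd : (4 <= d)%N.

Lemma ci_generator_homog (h : 'I_k) : gens h \is (idx_1_2 k h).-homog.
Proof.
rewrite /ci_generator /idx_1_2; case: ifP => _; last exact: dhomogXU.
by apply: dhomogD; apply: (@dhomogM _ _ _ 1%N _ 1%N); apply: dhomogXU.
Qed.

Definition cofactor_member (j : family_index n d k) : {mpoly C[n.+1]} :=
  if mdeg j.2 == (d - idx_1_2 k j.1)%N then 'X_[j.2] else 0.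

Lemma cofactor_member_homog j : cofactor_member j \is (d - idx_1_2 k j.1).-homog.
Proof.
by rewrite /cofactor_member; case: ifP => [h|_]; [rewrite dhomogX | exact: rpred0].
Qed.

Lemma family_memberE (j : family_index n d k) :
  family_member C j = gens j.1 * cofactor_member j.
Proof. by rewrite /family_member /cofactor_member; case: ifP => // _; rewrite mulr0. Qed.

Lemma family_polynomial_decomp (w0 : family_index n d k -> C) :
  decomp d (idx_1_2 k) gens (fun h => \sum_mu w0 (h, mu) *: cofactor_member (h, mu))
    (family_polynomial w0).
Proof.
split.
  move=> h; split; first exact: ci_generator_homog.
  by apply: rpred_sum => mu _; apply/dhomogZ/cofactor_member_homog.
rewrite /family_polynomial.
under [RHS]eq_bigr => h _ do rewrite mulr_sumr.
rewrite pair_bigA /=; apply: eq_bigr => -[h mu] _.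
by rewrite family_memberE /= scalerAr.
Qed.

Lemma family_polynomial_homog (w0 : family_index n d k -> C) :
  family_polynomial w0 \is d.-homog.
Proof.
apply: rpred_sum => j _; apply: dhomogZ; rewrite family_memberE.
have e : (d = idx_1_2 k j.1 + (d - idx_1_2 k j.1))%N.
  by rewrite subnKC // /idx_1_2; case: ifP => _; lia.
rewrite [X in X.-homog]e; apply: dhomogM; first exact: ci_generator_homog.
exact: cofactor_member_homog.
Qed.

End CompleteIntersection.

(** * A hypersurface outside the closure *)

Theorem theorem6p6 (C : closedFieldType) (hC : [pchar C] =i pred0)
  (d n k : nat) (hd : (4 <= d)%N) (hk : (2 <= k)%N) (hn : (k + 3 <= n)%N)
  (hbin : (k * (n - k + 1) <= 'C(n - k - 2 + d, n - k))%N)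
  (s : nat) (hs : (s <= k)%N) :
  exists f : {mpoly C[n.+1]},
    Fset d (idx_1_2 k) f /\ ~ in_closure d (Eset d (idx_ones s)) f.
Proof.
pose T := {ffun 'I_(n - k).+1 -> 'I_n.+1}.
pose J := family_index n d k.
have /fin_all_exists [h hh] (sigma : T) : exists h : {mpoly C[#|J|]}, h != 0 /\
    (injective sigma ->
     span (chart_equation (@mpolyC _ C) (generic_matrix C d n k)
       (@generic_coordinates C d n k) sigma)
       (mmap (@mpolyC _ C) (fun i => generic_coordinates C (enum_val i)) h)).
  (* A non-injective [sigma] gives no chart; [h = 1] keeps the product over all [sigma] nonzero. *)
  case: (injectiveP sigma) => [inj|ninj]; last first.
    by exists 1; split=> [|/ninj //]; exact: oner_neq0.
  have [h [hn0 hspan]] := chart_relation hd hk hn hbin (@mpolyC _ C)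
    (generic_matrix C d n k) (@generic_coordinates C d n k) inj.
  by exists h.
have Hn0 : \prod_sigma h sigma != 0 by apply/prodf_neq0 => sigma _; case: (hh sigma).
have [v hv] := mpoly_nonzero_value hC Hn0.
pose w0 (j : J) := v (enum_rank j).
have hw0 sigma : (h sigma).@[fun i => w0 (enum_val i)] != 0.
  rewrite (meval_eq _ (v2 := v)); last by move=> i; rewrite /w0 enum_valK.
  by apply: contraNneq hv => e; rewrite (bigD1 sigma) //= mevalM e mul0r.
pose f0 := family_polynomial w0.
have hom0 : f0 \is d.-homog by apply: family_polynomial_homog; lia.
have functional (sigma : T) : injective sigma ->
  exists P : Mon n d -> {mpoly C[_]}, forall a : 'M[C]_((n - k).+1, n.+1),
    (forall j j', a j (sigma j') = (j == j')%:R) ->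
    \sum_c f0@_(val (val c)) * (P c).@[chart_point w0 a] = 1 /\
    forall f, f \is d.-homog -> restrict idfun a f = 0 ->
      \sum_c f@_(val (val c)) * (P c).@[chart_point w0 a] = 0.
  by move=> inj; apply: (chart_functional (h := h sigma)) => //; case: (hh sigma) => _; apply.
(* The functional at one point of the chart of the first [n - k + 1] coordinates takes the value 1
   at [f0], so [f0] has a nonzero coefficient. *)
have [c0 hc0] : exists c0 : Mon n d, f0@_(val (val c0)) != 0.
  have le_r : ((n - k).+1 <= n.+1)%N by lia.
  pose sigma : T := [ffun j => widen_ord le_r j].
  have inj : injective sigma by move=> x y; rewrite !ffunE => /(congr1 val) /= /val_inj.
  have [P hP] := functional sigma inj.
  have [|e _] := hP (\matrix_(j, i) (i == sigma j)%:R).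
    by move=> j j'; rewrite mxE (inj_eq inj) eq_sym.
  apply/existsP; rewrite -[[exists _, _]]negbK negb_exists.
  apply/negP => /forallP h0; move: e; rewrite big1.
    by move/eqP; rewrite eq_sym oner_eq0.
  by move=> c _; move: (h0 c); rewrite negbK => /eqP ->; rewrite mul0r.
(* The form with coefficients [g] vanishes on the row space of [Y], tested on its representative in
   every chart. *)
pose bad (g : Mon n d -> C) (Y : 'M[C]_((n - k).+1, n.+1)) :=
  exists p : {mpoly C[n.+1]}, [/\ p \is d.-homog, forall c, g c = p@_(val (val c)) &
    forall sigma, minor sigma Y != 0 -> restrict idfun (chart_matrix sigma Y) p = 0].
have [sigma|e [Q [homQ Qf0 QE]]] := 
    projective_elimination (f0 := fun c : Mon n d => f0@_(val (val c))) (c0 := c0) (bad := bad) hc0.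
  case: (injectiveP sigma) => [inj|ninj]; last first.
    (* The minor of a non-injective [sigma] is identically zero, so the zero functional satisfies
       the condition vacuously. *)
    exists (fun _ _ => 0); split=> [c|Y]; first exact: homogenizable_const.
    by rewrite minor_non_injective ?eqxx.
  have [P hP] := functional sigma inj.
  exists (fun c a => (P c).@[chart_point w0 a]); split=> [c|Y hY].
    apply: homogenizable_poly => i; rewrite /chart_point.
    by case: (enum_val i) => x; [exact: homogenizable_entry | exact: homogenizable_const].
  have [|e1 e0] := hP (chart_matrix sigma Y).
    by move=> j j'; apply: chart_matrix_chart.
  split=> // g [p [homp eg hp]]; rewrite -[RHS](e0 p homp (hp _ hY)).
  by apply: eq_bigr => c _; rewrite eg.
exists f0; split.
  split; first exact: hom0; split.
    by apply: contraNneq hc0 => ->; rewrite mcoeff0.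
  exists (@ci_generator C n k), (fun h => \sum_mu w0 (h, mu) *: cofactor_member C (h, mu)).
  by split; [exact: family_polynomial_decomp | exact: ci_generator_regular].
(* [Q] is nonzero at [f0], so it remains to see that it vanishes at every member [g] of E(1,...,1),
   through the linear space contained in it. *)
move=> /(_ e Q homQ) hcl; case/eqP: Qf0; apply: hcl => g homg _ [_ [_ [fs [gs dec]]]].
have le_kn : (k <= n)%N by lia.
have [Y [hY hg]] := linear_subspace hs le_kn dec.
by apply: (QE (fun c => g@_(val (val c))) Y) => //; exists g.
Qed.
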